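(* Let $A$ be the selfadjoint Schrödinger operator on a star-graph with finitely many edges $E_1,\dots,E_n$, $E_l=[0,e_l)$, given by real-valued potentials $q_l\in L^1_{\mathrm{loc}}([0,e_l))$, boundary conditions at those outer vertices $e_l$ at which the limit circle case prevails, and the standard interface condition $$u_1(0)=\dots=u_n(0),\qquad \sum_{l=1}^n u_l'(0)=0 .$$ Denote by $m_l$ the Weyl function of the non-interacting operator $A_l$ (Dirichlet condition at $0$), $l=1,\dots,n$. Then a point $x\in\mathbb R$ belongs to the point spectrum $\sigma_p(A)$ if and only if one of the following alternatives takes place. (I/II) The point $x$ belongs to at least two of the point spectra $\sigma_p(A_l)$. In this case the multiplicity of the eigenvalue $x$ of $A$ is equal to $\#\{l\in\{1,\dots,n\}:\ x\in\sigma_p(A_l)\}-1$. (III) The limits $m_l(x):=\lim_{\varepsilon\downarrow0}m_l(x+i\varepsilon)$, $l=1,\dots,n$, all exist and are real, $\lim_{\varepsilon\downarrow0}\frac1{i\varepsilon}\big(m_l(x+i\varepsilon)-m_l(x)\big)\in[0,\infty)$ for all $l=1,\dots,n$, and $\sum_{l=1}^nm_l(x)=0$. In this case $x$ is a simple eigenvalue of $A$.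
   Context: Each $e_l\in(0,\infty]$; the endpoint $0$ of every edge corresponds to the interior vertex. If Weyl's limit circle case prevails for $-\frac{d^2}{dx^2}+q_l$ at $e_l$, a separated selfadjoint boundary condition at $e_l$ is fixed (i.e. $\lim_{x\to e_l}(u w_l'-u'w_l)(x)=0$ for a fixed nontrivial real solution $w_l$ of $-w''+q_lw=\lambda_0 w$ with some real $\lambda_0$); in the limit point case no condition is imposed at $e_l$. The operator $A$ acts in $H=\prod_{l=1}^nL_2(0,e_l)$ as $A(u_1,\dots,u_n)=(-u_1''+q_1u_1,\dots,-u_n''+q_nu_n)$ on the domain of all $(u_1,\dots,u_n)\in H$ such that $u_l,u_l'$ are (locally) absolutely continuous, $-u_l''+q_lu_l\in L_2(0,e_l)$, $u_l$ satisfies the boundary condition at $e_l$ (if present), and the standard interface condition holds. The non-interacting operator $A_l$ acts in $L_2(0,e_l)$ as $-u''+q_lu$, with the same boundary condition at $e_l$ (if present) and the Dirichlet condition $u(0)=0$. For $z\in\mathbb C\setminus\mathbb R$ let $\psi_l(\cdot,z)$ be a nontrivial solution of $-\psi''+q_l\psi=z\psi$ which lies in $L_2(0,e_l)$ and satisfies the boundary condition at $e_l$ (if present). The Weyl function of $A_l$ is $m_l(z):=\psi_l'(0,z)/\psi_l(0,z)$. $\sigma_p$ denotes the set of eigenvalues, and multiplicity of an eigenvalue is the dimension of its eigenspace. *)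

(* Defs.v *)
From mathcomp Require Export all_boot all_order all_algebra.
From mathcomp Require Export all_classical all_reals all_analysis.
From mathcomp Require Export complex.

Set Implicit Arguments.
Unset Strict Implicit.
Unset Printing Implicit Defensive.

Import Order.TTheory GRing.Theory Num.Theory numFieldNormedType.Exports.

Local Open Scope classical_set_scope.
Local Open Scope ring_scope.
Local Open Scope complex_scope.

(* Complex numbers are R[i]; the alias (R[i])^o carries the same ring structure
   together with the topology of the modulus and the R[i]-module structure.
   Functions on an edge [0, e) are total functions on R whose values outside
   [0, e) are never used. *)
Notation Cplx R := ((R[i])^o)%type.
Notation fun1 R := (R -> Cplx R).
Notation leb R := (@lebesgue_measure R).

Definition edge (R : realType) (e : \bar R) : set R :=
  [set x | 0 <= x /\ (x%:E < e)%E].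

(* The filter x --> e from below; the endpoint e is always in (0, +oo]. *)
Definition at_end (R : realType) (e : \bar R) : set_system R :=
  if e is r%:E then r^'- else pinfty_nbhs R.

Definition L1loc_real (R : realType) (e : \bar R) (f : R -> R) : Prop :=
  forall c, edge e c -> (leb R).-integrable `[0, c] (EFin \o f).

Definition L1loc (R : realType) (e : \bar R) (f : fun1 R) : Prop :=
  L1loc_real e (fun x => complex.Re (f x)) /\ L1loc_real e (fun x => complex.Im (f x)).

Definition cintegral (R : realType) (D : set R) (f : fun1 R) : Cplx R :=
  Rintegral (leb R) D (fun x => complex.Re (f x))
  +i* Rintegral (leb R) D (fun x => complex.Im (f x)).

Definition L2 (R : realType) (e : \bar R) (f : fun1 R) : Prop :=
  [/\ measurable_fun (edge e) (fun x => complex.Re (f x)),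
      measurable_fun (edge e) (fun x => complex.Im (f x)) &
      (\int[leb R]_(x in edge e) (complex.Re (f x) ^+ 2 + complex.Im (f x) ^+ 2)%:E < +oo)%E].

(* u is locally absolutely continuous on [0, e) with a.e. derivative du, i.e. u
   is the indefinite integral of the locally integrable function du.  When du is
   itself locally absolutely continuous, it is determined by u on all of [0, e)
   and is the classical (at 0: right) derivative of u. *)
Definition ac_deriv (R : realType) (e : \bar R) (u du : fun1 R) : Prop :=
  L1loc e du /\ forall x, edge e x -> u x = u 0 + cintegral `[0, x] du.

(* u, u' = du are locally absolutely continuous and f = - u'' + q u a.e. *)
Definition sl_expr (R : realType) (e : \bar R) (q : R -> R) (u du f : fun1 R)
    : Prop :=
  ac_deriv e u du /\
  exists2 ddu : fun1 R, ac_deriv e du ddu &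
    {ae leb R, forall x, edge e x -> f x = - ddu x + (q x)%:C * u x}.

Definition sl_solution (R : realType) (e : \bar R) (q : R -> R) (z : R[i])
    (u du : fun1 R) : Prop :=
  sl_expr e q u du (fun x => z * u x).

Definition nontrivial (R : realType) (e : \bar R) (u : fun1 R) : Prop :=
  exists2 x, edge e x & u x != 0.

(* The left endpoint 0 is regular, so "square integrable near e" amounts to
   "square integrable on (0, e)" for solutions. *)
Definition limit_circle (R : realType) (e : \bar R) (q : R -> R) : Prop :=
  forall (z : R[i]) (u du : fun1 R), sl_solution e q z u du -> L2 e u.

(* bw and dbw are the real solution w and its derivative w' fixing the
   separated boundary condition at e; they are ignored in the limit point
   case. *)
Record edge_data (R : realType) := EdgeData {
  len : \bar R;
  pot : R -> R;
  bw  : R -> R;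
  dbw : R -> R
}.

Definition admissible (R : realType) (E : edge_data R) : Prop :=
  [/\ (0%:E < len E)%E, L1loc_real (len E) (pot E) &
      limit_circle (len E) (pot E) ->
      exists lambda0 : R,
        sl_solution (len E) (pot E) lambda0%:C
          (fun x => (bw E x)%:C) (fun x => (dbw E x)%:C) /\
        nontrivial (len E) (fun x => (bw E x)%:C)].

Definition outer_bc (R : realType) (E : edge_data R) (u du : fun1 R) : Prop :=
  limit_circle (len E) (pot E) ->
  (u x * (dbw E x)%:C - du x * (bw E x)%:C : Cplx R) @[x --> at_end (len E)]
    --> (0 : Cplx R).

Definition edge_graph (R : realType) (E : edge_data R) (u du f : fun1 R)
    : Prop :=
  [/\ L2 (len E) u, L2 (len E) f, sl_expr (len E) (pot E) u du f &
      outer_bc E u du].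

(* Unbounded operators are given by their graphs, relating u to its image f. *)
Definition dirichlet_op (R : realType) (E : edge_data R) (u f : fun1 R)
    : Prop :=
  exists2 du : fun1 R, edge_graph E u du f & u 0 = 0.

Definition star_op (R : realType) (n : nat) (G : 'I_n -> edge_data R)
    (u f : 'I_n -> fun1 R) : Prop :=
  exists du : 'I_n -> fun1 R,
    [/\ forall l, edge_graph (G l) (u l) (du l) (f l),
        forall k l, u k 0 = u l 0 &
        \sum_(l < n) du l 0 = 0].

(* The zero vectors of L_2(0, e) and of the product space. *)
Definition null_edge (R : realType) (E : edge_data R) : set (fun1 R) :=
  [set u | {ae leb R, forall x, edge (len E) x -> u x = 0}].

Definition null_star (R : realType) (n : nat) (G : 'I_n -> edge_data R)
    : set ('I_n -> fun1 R) :=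
  [set u | forall l, null_edge (G l) (u l)].

(* Spectral notions for an operator, given by its graph T, in the quotient of V
   by the subspace N of functions vanishing almost everywhere. *)
Definition eigenvalue_of (K : fieldType) (V : lmodType K) (N : set V)
    (T : V -> V -> Prop) (z : K) : Prop :=
  exists2 v : V, ~ N v & T v (z *: v).

Definition has_multiplicity (K : fieldType) (V : lmodType K) (N : set V)
    (T : V -> V -> Prop) (z : K) (d : nat) : Prop :=
  exists b : 'I_d -> V,
    [/\ forall i, T (b i) (z *: b i),
        forall c : 'I_d -> K, N (\sum_(i < d) c i *: b i) ->
          forall i, c i = 0 &
        forall v, T v (z *: v) ->
          exists c : 'I_d -> K, N (v - \sum_(i < d) c i *: b i)].

Definition sigma_p_dirichlet (R : realType) (E : edge_data R) : set R :=
  [set x | @eigenvalue_of R[i] (fun1 R) (null_edge E) (dirichlet_op E) x%:C].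

Definition sigma_p_star (R : realType) (n : nat) (G : 'I_n -> edge_data R)
    : set R :=
  [set x | @eigenvalue_of R[i] ('I_n -> fun1 R) (null_star G) (star_op G) x%:C].

Definition star_multiplicity (R : realType) (n : nat) (G : 'I_n -> edge_data R)
    (x : R) (d : nat) : Prop :=
  @has_multiplicity R[i] ('I_n -> fun1 R) (null_star G) (star_op G) x%:C d.

Definition weyl_solution (R : realType) (E : edge_data R) (z : R[i])
    (psi dpsi : fun1 R) : Prop :=
  [/\ sl_solution (len E) (pot E) z psi dpsi, nontrivial (len E) psi,
      L2 (len E) psi & outer_bc E psi dpsi].

(* Only the values of m off the real axis are specified. *)
Definition weyl_function (R : realType) (E : edge_data R) (m : R[i] -> R[i])
    : Prop :=
  forall z : R[i], complex.Im z != 0 ->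
    exists psi dpsi : fun1 R,
      weyl_solution E z psi dpsi /\ m z = dpsi 0 / psi 0.

Definition dirichlet_count (R : realType) (n : nat) (G : 'I_n -> edge_data R)
    (x : R) : nat :=
  #|[set l : 'I_n | `[< sigma_p_dirichlet (G l) x >] ]%SET|.

Definition alternative_pole (R : realType) (n : nat) (G : 'I_n -> edge_data R)
    (x : R) : Prop :=
  (2 <= dirichlet_count G x)%N.

Definition alternative_zero (R : realType) (n : nat)
    (m : 'I_n -> R[i] -> R[i]) (x : R) : Prop :=
  exists mx : 'I_n -> R,
    [/\ forall l, (m l (x +i* eps) : Cplx R) @[eps --> 0^'+]
                    --> ((mx l)%:C : Cplx R),
        forall l, exists2 c : R, 0 <= c &
          ((m l (x +i* eps) - (mx l)%:C) / (0 +i* eps) : Cplx R)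
            @[eps --> 0^'+] --> (c%:C : Cplx R) &
        \sum_(l < n) mx l = 0].

(* Main.v *)
(* Call a solution of -u'' + q u = z u a Weyl solution if it is square integrable
   and satisfies the boundary condition; z may be real.  Solutions at different
   spectral parameters are compared through Lagrange's identity
   W(f, g)(t) - W(f, g)(s) = (z1 - z2) int_s^t f g for W(f, g) = f g' - f' g.
   If f and g are square integrable and W(f, g) does not vanish at the endpoint,
   then every solution y, recovered from y W(f, g) = f W(y, g) - g W(y, f), is
   square integrable; hence Wronskians of Weyl solutions vanish at the endpoint
   in the limit point case, and in the limit circle case they do so by the
   boundary condition.

   Let psi be the Weyl solution at x + i eps with psi(0) = 1.  Lagrange's
   identity gives Im m = eps |psi|^2 and, if u is a Weyl solution at x with
   u(0) = 1, m - u'(0) = i eps int (conj u) psi.  So |psi| stays bounded,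
   m -> u'(0) and (m - u'(0)) / (i eps) -> |u|^2.  Conversely, if the limits
   exist then |psi| is bounded, and the real solution u with u(0) = 1 and
   u'(0) = m(x), the locally uniform limit of psi, is a Weyl solution.  Thus an
   edge has, up to scaling, at most one Weyl solution u at x: u(0) = 0 means
   x in sigma_p(A_l), and u(0) <> 0 means that the limits in (III) exist, with
   m_l(x) = u'(0) / u(0).  It remains to match these solutions at the vertex. *)
Require Import Defs.
From mathcomp Require Import measurable_realfun.
From mathcomp Require Import ring lra.
Import Order.TTheory GRing.Theory Num.Theory numFieldNormedType.Exports.
Local Open Scope classical_set_scope.
Local Open Scope ring_scope.
Local Open Scope complex_scope.
Set Implicit Arguments.
Unset Strict Implicit.
Unset Printing Implicit Defensive.

(** * Locally integrable functions and their primitives *)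

(** Derivatives enter only through their primitives, so Lagrange's identity rests on an integrated
    product rule, which is Fubini on a triangle. Solutions are constructed for real parameters only,
    by a Neumann series; at [x +i* eps] they are supplied by the Weyl functions. Integrals over a
    whole edge are avoided too: square integrability becomes boundedness of [intsq f t], and
    Lagrange's identity is applied up to a point [t] near the endpoint, the Wronskian at [t] being
    an error term. The obstacle is the interchange of two limits, [eps] to 0 and [t] to the
    endpoint, since psi is close to u on compact intervals only. In both directions the cure is a
    point [a], chosen before [eps], beyond which a fixed function has a small tail: u when the
    limits are computed, the solution w of the boundary condition in the converse. Cauchy-Schwarz
    and the bound on psi, uniform in [eps], handle what lies beyond [a]; on a fixed compact interval
    the local estimate takes over as [eps] tends to 0. *)

Definition prim (R : realType) (f : R -> R) (t : R) : R :=
  Rintegral (leb R) `[0, t] f.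

(** Continuity relative to [[0, T]] is one-sided at 0 and ignores the arbitrary values that
    functions on an edge take outside it. *)
Definition econt (R : realType) (e : \bar R) (f : R -> R) : Prop :=
  forall T, edge e T -> {within `[0, T], continuous f}.

Section real_layer.
Context {R : realType} (e : \bar R).
Implicit Types (f g : R -> R) (s t T : R).
Local Notation L1 := (@L1loc_real R e).

Lemma edge_le s t : 0 <= s -> s <= t -> edge e t -> edge e s.
Proof.
move=> s0 st [_ te]; split => //; apply: le_lt_trans te; by rewrite lee_fin.
Qed.

Lemma edge_ge0 t : edge e t -> 0 <= t. Proof. by case. Qed.

Lemma econt_L1loc f : econt e f -> L1 f.
Proof.
move=> cf c ec; apply: continuous_compact_integrable; first exact: segment_compact.
exact: cf.
Qed.

Lemma econtD f g : econt e f -> econt e g -> econt e (fun x => f x + g x).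
Proof. by move=> cf cg T eT x; apply: continuousD; [exact: cf|exact: cg]. Qed.

Lemma econtN f : econt e f -> econt e (fun x => - f x).
Proof. by move=> cf T eT x; apply: continuousN; exact: cf. Qed.

Lemma econtB f g : econt e f -> econt e g -> econt e (fun x => f x - g x).
Proof. by move=> cf cg; apply: econtD => //; exact: econtN. Qed.

Lemma econtM f g : econt e f -> econt e g -> econt e (fun x => f x * g x).
Proof. by move=> cf cg T eT x; apply: continuousM; [exact: cf|exact: cg]. Qed.

Lemma econt_cst (a : R) : econt e (fun=> a).
Proof. by move=> T eT x; apply: cst_continuous. Qed.

Lemma eq_econt f g : (forall x, edge e x -> f x = g x) -> econt e f -> econt e g.
Proof.
move=> fg cf T eT; apply: (subspace_eq_continuous _ (cf T eT)) => x.
rewrite inE /= in_itv /= => /andP[x0 xT]; apply: fg; exact: edge_le eT.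
Qed.

Lemma eq_L1loc_real f g : (forall x, edge e x -> f x = g x) -> L1 f -> L1 g.
Proof.
move=> fg Lf T eT; apply: eq_integrable (Lf T eT) => // x.
rewrite inE /= in_itv /= => /andP[x0 xT]; congr EFin; apply: fg; exact: edge_le eT.
Qed.

Lemma L1loc_realD f g : L1 f -> L1 g -> L1 (fun x => f x + g x).
Proof. by move=> Lf Lg T eT; exact: (integrableD _ (Lf T eT) (Lg T eT)). Qed.

Lemma L1loc_realZ (k : R) f : L1 f -> L1 (fun x => k * f x).
Proof. by move=> Lf T eT; exact: (integrableZl _ k (Lf T eT)). Qed.

Lemma L1loc_realN f : L1 f -> L1 (fun x => - f x).
Proof. by move=> /(L1loc_realZ (-1)); apply: eq_L1loc_real => x _; rewrite mulN1r. Qed.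

Lemma L1loc_realB f g : L1 f -> L1 g -> L1 (fun x => f x - g x).
Proof. by move=> Lf Lg; apply: L1loc_realD => //; exact: L1loc_realN. Qed.

Lemma L1loc_real_norm f : L1 f -> L1 (fun x => `|f x|).
Proof. by move=> Lf T eT; apply: integrable_norm; exact: Lf. Qed.

Lemma L1loc_real_cst (a : R) : L1 (fun=> a).
Proof. exact/econt_L1loc/econt_cst. Qed.

Lemma L1loc_realM f g : econt e f -> L1 g -> L1 (fun x => f x * g x).
Proof.
move=> cf Lg T eT; have cf' := cf T eT.
apply: (integrableMr _ _ _ (Lg T eT)) => //.
  by apply: subspace_continuous_measurable_fun.
have /compact_bounded[M [Mr HM]] : compact (f @` `[0, T]).
  by apply: continuous_compact => //; exact: segment_compact.
exists M; split=> // y My x Tx; apply: HM => //; by exists x.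
Qed.

Lemma prim0 f : prim f 0 = 0.
Proof. by rewrite /prim set_itv1 Rintegral_set1. Qed.

Lemma prim_cst (a : R) t : 0 <= t -> prim (fun=> a) t = a * t.
Proof.
move=> t0; rewrite /prim Rintegral_cst //= lebesgue_measure_itv /= lte_fin.
by case: ltP => t1; rewrite /= ?subr0 //; congr (_ * _); apply/le_anti; rewrite t0 t1.
Qed.

Lemma eq_prim f g t : (forall x, 0 <= x -> x <= t -> f x = g x) ->
  prim f t = prim g t.
Proof.
move=> fg; apply: eq_Rintegral => x; rewrite inE /= in_itv /= => /andP[x0 xT].
exact: fg.
Qed.

Lemma primD f g t : edge e t -> L1 f -> L1 g ->
  prim (fun x => f x + g x) t = prim f t + prim g t.
Proof. by move=> et Lf Lg; apply: RintegralD => //; [exact: Lf|exact: Lg]. Qed.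

Lemma primZ (k : R) f t : edge e t -> L1 f ->
  prim (fun x => k * f x) t = k * prim f t.
Proof. by move=> et Lf; apply: RintegralZl => //; exact: Lf. Qed.

Lemma primB f g t : edge e t -> L1 f -> L1 g ->
  prim (fun x => f x - g x) t = prim f t - prim g t.
Proof. by move=> et Lf Lg; apply: RintegralB => //; [exact: Lf|exact: Lg]. Qed.

Lemma primN f t : edge e t -> L1 f -> prim (fun x => - f x) t = - prim f t.
Proof.
move=> et Lf; rewrite -mulN1r -primZ //; apply: eq_prim => x _ _.
by rewrite mulN1r.
Qed.

Lemma prim_incr f s t : edge e t -> 0 <= s -> s <= t -> L1 f ->
  prim f t - prim f s = Rintegral (leb R) `]s, t] f.
Proof.
by move=> et s0 st Lf; apply: Rintegral_itvB => //; exact: Lf.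
Qed.

Lemma L1loc_real_sub f s t : edge e t -> 0 <= s -> L1 f ->
  (leb R).-integrable `]s, t] (EFin \o f).
Proof.
move=> et s0 Lf; apply: (integrableS _ _ _ (Lf t et)) => //.
by apply: subset_itv; rewrite bnd_simp.
Qed.

Lemma ler_prim f g s t : edge e t -> 0 <= s -> s <= t -> L1 f -> L1 g ->
  (forall x, s <= x -> x <= t -> f x <= g x) ->
  prim f t - prim f s <= prim g t - prim g s.
Proof.
move=> et s0 st Lf Lg fg; rewrite !prim_incr //; apply: le_Rintegral => //.
- exact: L1loc_real_sub.
- exact: L1loc_real_sub.
- by move=> x /=; rewrite in_itv /= => /andP[sx xt]; apply: fg => //; exact: ltW.
Qed.

Lemma ler_prim0 f g t : edge e t -> L1 f -> L1 g ->
  (forall x, 0 <= x -> x <= t -> f x <= g x) -> prim f t <= prim g t.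
Proof.
move=> et Lf Lg fg; have t0 := edge_ge0 et.
by have := ler_prim et (lexx 0) t0 Lf Lg fg; rewrite !prim0 !subr0.
Qed.

Lemma prim_ge0 f t : (forall x, 0 <= x -> x <= t -> 0 <= f x) -> 0 <= prim f t.
Proof.
by move=> f0; apply: Rintegral_ge0 => x /=; rewrite in_itv /= => /andP[]; exact: f0.
Qed.

Lemma prim_homo f s t : edge e t -> 0 <= s -> s <= t -> L1 f ->
  (forall x, s <= x -> x <= t -> 0 <= f x) -> prim f s <= prim f t.
Proof.
move=> et s0 st Lf f0; rewrite -subr_ge0 prim_incr //; apply: Rintegral_ge0 => x /=.
by rewrite in_itv /= => /andP[sx xt]; apply: f0 => //; exact: ltW.
Qed.

Lemma norm_prim f s t : edge e t -> 0 <= s -> s <= t -> L1 f ->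
  `|prim f t - prim f s| <= prim (fun x => `|f x|) t - prim (fun x => `|f x|) s.
Proof.
move=> et s0 st Lf; rewrite !prim_incr //; last exact: L1loc_real_norm.
apply: le_normr_Rintegral => //; exact: L1loc_real_sub.
Qed.

Lemma prim_cont f : L1 f -> econt e (prim f).
Proof.
move=> Lf T eT; apply: parameterized_integral_continuous; first exact: edge_ge0 eT.
exact: Lf.
Qed.

Lemma prim_ae f g t : edge e t -> L1 f -> L1 g ->
  {ae leb R, forall x, edge e x -> f x = g x} -> prim f t = prim g t.
Proof.
move=> et Lf Lg fg; congr fine; apply: ae_eq_integral => //.
- exact: (measurable_int _ (Lf t et)).
- exact: (measurable_int _ (Lg t et)).
- case: fg => N [mN N0 fgN]; exists N; split => //; apply: subset_trans fgN; apply: subsetC => x fg /=; rewrite in_itv /= => /andP[x0 xt].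
  by rewrite fg //; exact: edge_le et.
Qed.

End real_layer.

(** * Integration by parts for primitives *)

Section product_rule.
Context {R : realType} (e : \bar R).
Implicit Types (f g : R -> R) (s t T : R).
Local Notation L1 := (@L1loc_real R e).

Lemma EFin_Rintegral (D : set R) f : measurable D -> (leb R).-integrable D (EFin \o f) ->
  (Rintegral (leb R) D f)%:E = (\int[leb R]_(x in D) (f x)%:E)%E.
Proof. by move=> mD fi; rewrite /Rintegral fineK //; exact: integrable_fin_num. Qed.

Lemma mem_itvcc (a b x : R) : (x \in `[a, b]%classic) = (a <= x <= b).
Proof. by apply/idP/idP; rewrite inE /= in_itv. Qed.

Lemma mem_set_pred (T : Type) (p : pred T) (x : T) : (x \in [set y | p y]) = p x.
Proof. by apply/idP/idP; rewrite inE. Qed.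

(* Fubini on the triangle s <= r <= t. *)
Lemma prim_triangle f g t : edge e t -> L1 f -> L1 g ->
  prim (fun r => f r * prim g r) t = prim (fun s => g s * (prim f t - prim f s)) t.
Proof.
move=> et Lf Lg; have t0 := edge_ge0 et.
have ift := Lf t et; have igt := Lg t et.
have mA : measurable (`[0, t]%classic : set R) by [].
set A : set R := `[0, t]%classic.
pose fA : R -> R := f \_ A; pose gA : R -> R := g \_ A.
(* Both factors are extended by zero and the indicator cuts out the triangle, so that Fubini applies
   on the whole plane. *)
pose I (p : R * R) : \bar R := (fA p.1 * gA p.2 * \1_[set q : R * R | q.2 <= q.1] p)%:E.
have ifA : (leb R).-integrable setT (EFin \o fA).
  rewrite -restrict_EFin; exact: (proj1 (@integrable_mkcond _ _ _ (leb R) _ (EFin \o f) mA) ift).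
have igA : (leb R).-integrable setT (EFin \o gA).
  rewrite -restrict_EFin; exact: (proj1 (@integrable_mkcond _ _ _ (leb R) _ (EFin \o g) mA) igt).
have mfA : measurable_fun setT fA by apply/measurable_EFinP; exact: (measurable_int _ ifA).
have mgA : measurable_fun setT gA by apply/measurable_EFinP; exact: (measurable_int _ igA).
have mI : measurable_fun setT I.
  apply/measurable_EFinP; apply: measurable_funM.
    by apply: measurable_funM; apply: measurableT_comp.
  apply: measurable_indic.
  have := @measurable_fun_ler _ _ R setT (@snd R R) (@fst R R).
  move=> /(_ measurable_snd measurable_fst measurableT [set true]).
  by rewrite setTI; apply.
have iI : ((leb R) \x (leb R))%E.-integrable setT I.
  (* Without the indicator the inner integral is at most [|fA x|] times the L1 norm of [gA]. *)
  apply/integrable12ltyP => //.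
  apply: (@le_lt_trans _ _ (\int[leb R]_x ((`|fA x| * Rintegral (leb R) setT (fun y => `|gA y|))%:E))%E).
    apply: ge0_le_integral => //=.
    - by move=> x _; apply: integral_ge0.
    - have mI' : measurable_fun setT (abse \o I) by exact: measurableT_comp.
      exact: (@measurable_fun_fubini_tonelli_F _ _ _ _ R (leb R) _ mI' (fun p => abse_ge0 (I p))).
    - apply/measurable_EFinP; apply: measurable_funM => //.
      exact: measurableT_comp.
    move=> x _; rewrite EFinM EFin_Rintegral //; last exact: (integrable_norm igA).
    rewrite -integralZl //; last exact: (integrable_norm igA).
    apply: ge0_le_integral => //=.
    - have /measurable_EFinP := measurableT_comp mI (@measurable_pair1 _ _ _ _ x).
      by move=> h; apply/measurable_EFinP; exact: measurableT_comp.
    - apply/measurable_EFinP; apply: measurable_funM => //; exact: measurableT_comp.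
    - move=> y _; rewrite -EFinM lee_fin !normrM ler_piMr //.
      by rewrite indicE; case: (_ \in _); rewrite ?normr1 ?normr0.
  under eq_integral do rewrite mulrC EFinM.
  rewrite integralZl //; last exact: (integrable_norm ifA).
  rewrite -EFin_Rintegral //; last exact: (integrable_norm ifA).
  by rewrite -EFinM ltry.
have := Fubini iI.
have L : (\int[leb R]_x \int[leb R]_y I (x, y) =
          \int[leb R]_(x in A) (f x * prim g x)%:E)%E.
  rewrite [RHS]integral_mkcond; apply: eq_integral => x _ /=.
  rewrite patchE; case: ifPn => [xA|xA]; last first.
    rewrite (_ : (fun y => _) = fun=> 0%E) ?integral0 //.
    by apply/funext => y; rewrite /I /fA patchE (negbTE xA) /= !mul0r.
  have xt : edge e x.
    by move: xA; rewrite inE /A /= in_itv /= => /andP[? ?]; exact: edge_le et.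
  rewrite -(primZ (f x) xt Lg) EFin_Rintegral //; last exact: (L1loc_realZ (f x) Lg xt).
  rewrite [RHS]integral_mkcond; apply: eq_integral => y _.
  have mle : ((x, y) \in [set q : R * R | q.2 <= q.1]) = (y <= x) by rewrite mem_set_pred.
  rewrite /I /fA /gA !patchE /= indicE xA mle /A !mem_itvcc.
  move: xA; rewrite /A mem_itvcc => /andP[x0 xt'].
  case: (leP y x) => yx; rewrite ?andbF ?mulr0 // ?mulr1 andbT (le_trans yx xt') andbT.
  by case: ifP => //; rewrite mulr0.
have Rr : (\int[leb R]_y \int[leb R]_x I (x, y) =
          \int[leb R]_(y in A) (g y * (prim f t - prim f y))%:E)%E.
  rewrite [RHS]integral_mkcond; apply: eq_integral => y _ /=.
  rewrite patchE; case: ifPn => [yA|yA]; last first.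
    rewrite (_ : (fun x => _) = fun=> 0%E) ?integral0 //.
    by apply/funext => x; rewrite /I /gA !patchE /= (negbTE yA) /= mulr0 mul0r.
  move: yA; rewrite inE /A /= in_itv /= => /andP[y0 yt].
  rewrite (prim_incr et) // Rintegral_itv_obnd_cbnd; last exact: L1loc_real_sub Lf.
  have ify : (leb R).-integrable `[y, t] (EFin \o f).
    by apply: (integrableS _ _ _ ift) => //; apply: subset_itv; rewrite bnd_simp.
  rewrite -RintegralZl // EFin_Rintegral //; last exact: (integrableZl _ (g y) ify).
  rewrite [RHS]integral_mkcond; apply: eq_integral => x _.
  have mle : ((x, y) \in [set q : R * R | q.2 <= q.1]) = (y <= x) by rewrite mem_set_pred.
  rewrite /I /fA /gA !patchE /= indicE mle /A !mem_itvcc y0 yt.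
  case: (leP y x) => yx; rewrite /= ?mulr0 // ?mulr1 (le_trans y0 yx) /=.
  by case: ifP => _; rewrite ?mul0r // mulrC.
by rewrite L Rr /prim /Rintegral => ->.
Qed.

(** Fubini turns [f * prim g] into [g * (prim f t - prim f)]; the second half cancels against
    [prim f * g], and [prim f t] times the integral of [g] remains. *)
Lemma primM f g t : edge e t -> L1 f -> L1 g ->
  prim f t * prim g t = prim (fun r => prim f r * g r + f r * prim g r) t.
Proof.
move=> et Lf Lg; have cf := prim_cont Lf; have cg := prim_cont Lg.
have L1' : L1 (fun r => f r * prim g r).
  by apply: eq_L1loc_real (L1loc_realM cg Lf) => x _; rewrite mulrC.
rewrite (primD et (L1loc_realM cf Lg) L1') (prim_triangle et) //.
rewrite -(primD et) //; last 2 first.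
- exact: L1loc_realM.
- by apply: eq_L1loc_real (L1loc_realB (L1loc_realZ (prim f t) Lg) (L1loc_realM cf Lg)) => x _; ring.
by rewrite -(primZ _ et) //; apply: eq_prim => x _ _; ring.
Qed.

End product_rule.

(** * Linear systems with locally integrable coefficients *)

Section picard.
Context {R : realType} (e : \bar R).
Implicit Types (f g : R -> R) (s t T : R).
Local Notation L1 := (@L1loc_real R e).

(** Dominated convergence on each [[0, t]]: pointwise convergence of the Neumann series is then
    enough to pass to the limit in its integral equations. *)
Lemma prim_dominated (F : nat -> R -> R) f g :
  (forall n, L1 (F n)) -> L1 g ->
  (forall x, edge e x -> F n x @[n --> \oo] --> f x) ->
  (forall n x, edge e x -> `|F n x| <= g x) ->
  L1 f /\ forall t, edge e t -> prim (F n) t @[n --> \oo] --> prim f t.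
Proof.
move=> LF Lg Ff Fg.
have key t : edge e t -> (leb R).-integrable `[0, t] (EFin \o f) /\
    prim (F n) t @[n --> \oo] --> prim f t.
  move=> et.
  have sub x : `[0, t]%classic x -> edge e x.
    by rewrite /= in_itv /= => /andP[? ?]; exact: edge_le et.
  have mF n : measurable_fun (`[0, t]%classic : set R) (EFin \o F n).
    exact: (measurable_int _ (LF n t et)).
  have Ff' x : `[0, t]%classic x -> (EFin \o F n) x @[n --> \oo] --> (EFin \o f) x.
    by move=> /sub ex; apply/fine_cvgP; split; [exact: nearW|exact: Ff].
  have mf : measurable_fun (`[0, t]%classic : set R) (EFin \o f).
    exact: (emeasurable_fun_cvg _ _ mF Ff').
  have mt : measurable (`[0, t]%classic : set R) by [].
  have ae1 : {ae leb R, forall x, `[0, t]%classic x ->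
      (EFin \o F n) x @[n --> \oo] --> (EFin \o f) x} by exact: aeW.
  have ae2 : {ae leb R, forall x n, `[0, t]%classic x ->
      (`|(EFin \o F n) x| <= (EFin \o g) x)%E}.
    by apply: aeW => x n /sub ex; rewrite lee_fin; exact: Fg.
  have [|||if_ _ cf] := @dominated_convergence _ _ _ (leb R) _ mt
    (fun n => EFin \o F n) (EFin \o f) (EFin \o g) mF mf.
  - exact: ae1.
  - exact: Lg.
  - exact: ae2.
  split => //; rewrite /prim /Rintegral.
  apply: fine_cvg; rewrite fineK //.
  exact: integrable_fin_num.
by split=> [t et|t et]; have [] := key t et.
Qed.

(** The power rule, by induction from the product rule. It is the source of the factorials in the
    bound on the Neumann series. *)
Lemma prim_pow h t n : edge e t -> L1 h ->
  prim (fun x => h x * prim h x ^+ n) t *+ n.+1 = prim h t ^+ n.+1.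
Proof.
move=> et Lh; elim: n t et => [|n IH] t et.
  by rewrite mulr1n expr1; apply: eq_prim => x _ _; rewrite expr0 mulr1.
have ch := prim_cont Lh.
have cpow k : econt e (fun x => prim h x ^+ k).
  elim: k => [|k IHk]; first exact: econt_cst.
  by apply: eq_econt (econtM ch IHk) => x _; rewrite exprS.
have Lk k : L1 (fun x => h x * prim h x ^+ k).
  by apply: eq_L1loc_real (L1loc_realM (cpow k) Lh) => x _; rewrite mulrC.
rewrite exprS -IH // -[in RHS]mulr_natl -(primZ n.+1%:R et (Lk n)).
rewrite (primM et Lh (L1loc_realZ _ (Lk n))) -[LHS]mulr_natl -(primZ _ et (Lk n.+1)).
apply: eq_prim => x x0 xt; have ex := edge_le x0 xt et.
rewrite (primZ _ ex) // [n.+1%:R * prim _ _]mulr_natl IH //.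
by rewrite -[n.+2]addn1 natrD !exprS; ring.
Qed.

Variables (Q : R -> R) (a b : R).
Hypothesis LQ : L1 Q.

(** The terms, not the partial sums, of the Neumann series of the system u' = du, du' = Q u with
    initial values [a] and [b]. *)
Fixpoint picard (n : nat) : (R -> R) * (R -> R) :=
  if n is k.+1 then
    (prim (picard k).2, prim (fun x => Q x * (picard k).1 x))
  else (fun=> a, fun=> b).

(** [h] dominates both nonzero entries, 1 and [Q], of the coefficient matrix, so that one majorant
    serves both components. *)
Let h x := 1 + `|Q x|.
Let p := prim h.
Let M := `|a| + `|b|.

Let Lh : L1 h. Proof. exact: (L1loc_realD (L1loc_real_cst 1) (L1loc_real_norm LQ)). Qed.
Let h_ge0 x : 0 <= h x. Proof. exact: addr_ge0. Qed.
Let M_ge0 : 0 <= M. Proof. exact: addr_ge0. Qed.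
Let p_ge0 t : 0 <= p t. Proof. exact: prim_ge0. Qed.

Lemma picard_cont n : econt e (picard n).1 /\ econt e (picard n).2.
Proof.
elim: n => [|n [c1 c2]] /=; first by split; exact: econt_cst.
split; apply: prim_cont; first exact: econt_L1loc.
by apply: eq_L1loc_real (L1loc_realM c1 LQ) => x _; rewrite mulrC.
Qed.

Let LQpic n : L1 (fun x => Q x * (picard n).1 x).
Proof.
by have [c1 _] := picard_cont n; apply: eq_L1loc_real (L1loc_realM c1 LQ) => x _; rewrite mulrC.
Qed.

(** Each step integrates at most [h] times the previous bound, which by the power rule is the next
    term of the exponential series at [p t]. *)
Lemma picard_bound n t : edge e t ->
  `|(picard n).1 t| <= M * exp_coeff (p t) n /\
  `|(picard n).2 t| <= M * exp_coeff (p t) n.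
Proof.
elim: n t => [|n IH] t et.
  by rewrite /exp_coeff /= expr0 divr1 mulr1 lerDl lerDr.
have t0 := edge_ge0 et.
have [c1 c2] := picard_cont n.
have Lhp : L1 (fun x => h x * p x ^+ n).
  have cpow k : econt e (fun x => p x ^+ k).
    elim: k => [|k IHk]; first exact: econt_cst.
    by apply: eq_econt (econtM (prim_cont Lh) IHk) => x _; rewrite exprS.
  by apply: eq_L1loc_real (L1loc_realM (cpow n) Lh) => x _; rewrite mulrC.
have Lb : L1 (fun x => M / n`!%:R * (h x * p x ^+ n)) by exact: L1loc_realZ.
have step f : L1 f -> (forall x, edge e x -> `|f x| <= M / n`!%:R * (h x * p x ^+ n)) ->
    `|prim f t| <= M * exp_coeff (p t) n.+1.
  move=> Lf fb.
  have := norm_prim et (lexx 0) t0 Lf; rewrite !prim0 !subr0 => /le_trans; apply.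
  apply: le_trans (ler_prim0 et (L1loc_real_norm Lf) Lb _) _.
    by move=> x x0 xt; apply: fb; exact: edge_le et.
  rewrite (primZ _ et Lhp).
  have := prim_pow n et Lh; rewrite -/p => pp.
  rewrite /exp_coeff /= -pp -mulr_natl factS natrM.
  rewrite le_eqVlt; apply/orP; left; apply/eqP.
  have fn0 : n`!%:R != 0 :> R by rewrite pnatr_eq0 -lt0n fact_gt0.
  have n0 : n.+1%:R != 0 :> R by rewrite pnatr_eq0.
  by field; rewrite fn0 nat1r n0.
have hb x : edge e x -> M * exp_coeff (p x) n <= M / n`!%:R * (h x * p x ^+ n).
  move=> ex; rewrite /exp_coeff /=; rewrite -subr_ge0.
  have -> : M / n`!%:R * (h x * p x ^+ n) - M * (p x ^+ n / n`!%:R) =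
            `|Q x| * (M * (p x ^+ n / n`!%:R)) by rewrite /h; ring.
  by rewrite !mulr_ge0 ?exprn_ge0.
split => /=.
  apply: step => [|x ex]; first exact: econt_L1loc.
  by apply: le_trans (hb x ex); case: (IH x ex).
apply: step => [|x ex]; first exact: LQpic.
rewrite normrM.
apply: (@le_trans _ _ (h x * (M * exp_coeff (p x) n))).
  by apply: ler_pM => //; [rewrite /h lerDr|case: (IH x ex)].
by rewrite /exp_coeff /= le_eqVlt; apply/orP; left; apply/eqP; ring.
Qed.

Let S1 n t := \sum_(0 <= k < n) (picard k).1 t.
Let S2 n t := \sum_(0 <= k < n) (picard k).2 t.

Let LS n : econt e (S1 n) /\ econt e (S2 n).
Proof.
elim: n => [|n [c1 c2]].
  split; apply: (@eq_econt _ _ (fun=> 0)); try exact: econt_cst;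
    by move=> x _; rewrite /S1 /S2 big_geq.
have [d1 d2] := picard_cont n.
split.
  by apply: eq_econt (econtD c1 d1) => x _; rewrite /S1 big_nat_recr.
by apply: eq_econt (econtD c2 d2) => x _; rewrite /S2 big_nat_recr.
Qed.

Let LQS n : L1 (fun x => Q x * S1 n x).
Proof. by have [c1 _] := LS n; apply: eq_L1loc_real (L1loc_realM c1 LQ) => x _; rewrite mulrC. Qed.

(** The partial sums are Picard iterates; the shift from [n] to [n.+1] disappears in the limit. *)
Let S_rec n t : edge e t -> S1 n.+1 t = a + prim (S2 n) t /\
  S2 n.+1 t = b + prim (fun x => Q x * S1 n x) t.
Proof.
move=> et; elim: n => [|n [IH1 IH2]].
  rewrite /S1 /S2 !big_nat1 /=; split; rewrite -[LHS]addr0; congr (_ + _).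
    rewrite (@eq_prim _ _ (fun=> 0)) ?prim_cst ?mul0r //; first exact: edge_ge0 et.
    by move=> x _ _; rewrite big_geq.
  rewrite (@eq_prim _ _ (fun=> 0)) ?prim_cst ?mul0r //; first exact: edge_ge0 et.
  by move=> x _ _; rewrite big_geq ?mulr0.
have [c1 c2] := LS n; have [d1 d2] := picard_cont n.
split.
  rewrite /S1 big_nat_recr //= -/(S1 n.+1 t) IH1 -addrA; congr (_ + _).
  rewrite -(primD et) //; try exact: econt_L1loc.
  by apply: eq_prim => x _ _; rewrite /S2 big_nat_recr.
rewrite /S2 big_nat_recr //= -/(S2 n.+1 t) IH2 -addrA; congr (_ + _).
rewrite -(primD et) //; try exact: LQpic.
by apply: eq_prim => x _ _; rewrite /S1 big_nat_recr //= mulrDr.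
Qed.

(** The second half is uniform in [n] and supplies the majorant for dominated convergence. *)
Let Sbound (c : nat -> R) t : (forall k, `|c k| <= M * exp_coeff (p t) k) ->
  cvgn (series c) /\ forall n, `|series c n| <= M * expR (p t).
Proof.
move=> cb.
have ce : cvgn (series (exp_coeff (p t))) by exact: is_cvg_series_exp_coeff.
split.
  apply: normed_cvg; apply: (@series_le_cvg _ _ (fun k => M * exp_coeff (p t) k)) => //.
  - by move=> k; exact: normr_ge0.
  - by move=> k; rewrite mulr_ge0 // exp_coeff_ge0.
  - exact: is_cvg_seriesZ.
move=> n; apply: le_trans (ler_norm_sum _ _ _) _.
apply: (@le_trans _ _ (M * series (exp_coeff (p t)) n)).
  by rewrite /series /= mulr_sumr; apply: ler_sum => k _; exact: cb.
rewrite ler_wpM2l //; apply: nondecreasing_cvgn_le => //.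
by apply: nondecreasing_series => k _ _; exact: exp_coeff_ge0.
Qed.

Lemma linear_system_sol : exists u du : R -> R,
  [/\ econt e u, econt e du,
      forall t, edge e t -> u t = a + prim du t &
      forall t, edge e t -> du t = b + prim (fun x => Q x * u x) t].
Proof.
pose u t := limn (S1 ^~ t); pose du t := limn (S2 ^~ t).
pose G t := M * expR (p t).
have cu t : edge e t -> S1 n t @[n --> \oo] --> u t.
  by move=> et; have [c _] := Sbound (fun k => proj1 (picard_bound k et)); exact: c.
have cdu t : edge e t -> S2 n t @[n --> \oo] --> du t.
  by move=> et; have [c _] := Sbound (fun k => proj2 (picard_bound k et)); exact: c.
have cG : econt e G.
  move=> T eT x; apply: cvgMr.
  apply: (@continuous_comp (subspace `[0, T]) _ _ p expR x).
    exact: (prim_cont Lh eT).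
  exact: continuous_expR.
have [Ldu Pdu] : L1 du /\ forall t, edge e t -> prim (S2 n) t @[n --> \oo] --> prim du t.
  apply: (@prim_dominated S2 du G) => //.
  - by move=> n; apply: econt_L1loc; case: (LS n).
  - exact: econt_L1loc.
  - by move=> n x ex; have [_ c] := Sbound (fun k => proj2 (picard_bound k ex)); exact: c.
have [LQu PQu] : L1 (fun x => Q x * u x) /\ forall t, edge e t ->
    prim (fun x => Q x * S1 n x) t @[n --> \oo] --> prim (fun x => Q x * u x) t.
  apply: (@prim_dominated _ _ (fun x => G x * `|Q x|)) => //.
  - exact: L1loc_realM cG (L1loc_real_norm LQ).
  - by move=> x ex; apply: cvgMr; exact: cu.
  - move=> n x ex; have [_ c] := Sbound (fun k => proj1 (picard_bound k ex)).
    by rewrite normrM mulrC ler_wpM2r //; exact: c.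
have eu t : edge e t -> u t = a + prim du t.
  move=> et; apply: (@cvg_unique _ _ (S1 n.+1 t @[n --> \oo])) => //.
    by have := cu t et; rewrite -(cvg_shiftS (S1 ^~ t)).
  rewrite (_ : (fun n => S1 n.+1 t) = fun n => a + prim (S2 n) t); last first.
    by apply/funext => n; case: (S_rec n et).
  by apply: cvgD; [exact: cvg_cst|exact: Pdu].
have edu t : edge e t -> du t = b + prim (fun x => Q x * u x) t.
  move=> et; apply: (@cvg_unique _ _ (S2 n.+1 t @[n --> \oo])) => //.
    by have := cdu t et; rewrite -(cvg_shiftS (S2 ^~ t)).
  rewrite (_ : (fun n => S2 n.+1 t) = fun n => b + prim (fun x => Q x * S1 n x) t); last first.
    by apply/funext => n; case: (S_rec n et).
  by apply: cvgD; [exact: cvg_cst|exact: PQu].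
exists u, du; split => //.
- have := econtD (@econt_cst _ e a) (prim_cont Ldu); apply: eq_econt => x ex.
  by rewrite eu.
- have := econtD (@econt_cst _ e b) (prim_cont LQu); apply: eq_econt => x ex.
  by rewrite edu.
Qed.

End picard.

(** * Complex-valued functions *)

Section complex_numbers.
Context {R : realType}.
Implicit Types (x y z : R[i]).
Local Notation Re := complex.Re.
Local Notation Im := complex.Im.

Lemma ReD x y : Re (x + y) = Re x + Re y. Proof. by case: x y => ? ? []. Qed.
Lemma ImD x y : Im (x + y) = Im x + Im y. Proof. by case: x y => ? ? []. Qed.
Lemma ReN x : Re (- x) = - Re x. Proof. by case: x. Qed.
Lemma ImN x : Im (- x) = - Im x. Proof. by case: x. Qed.
Lemma ReM x y : Re (x * y) = Re x * Re y - Im x * Im y.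
Proof. by case: x y => ? ? []. Qed.
Lemma ImM x y : Im (x * y) = Re x * Im y + Im x * Re y.
Proof. by case: x y => ? ? []. Qed.
Lemma Re_conjc x : Re (conjc x) = Re x. Proof. by case: x. Qed.
Lemma Im_conjc x : Im (conjc x) = - Im x. Proof. by case: x. Qed.

Definition ReImE := (ReD, ImD, ReN, ImN, ReM, ImM, Re_conjc, Im_conjc).

Lemma complex_ext x y : Re x = Re y -> Im x = Im y -> x = y.
Proof. by case: x y => ? ? [? ?] /= -> ->. Qed.

(** The modulus on [R[i]] is complex-valued; its square taken in [R] is a polynomial in the
    components, so that estimates reduce to [ring] and [lra]. *)
Definition normsq (z : R[i]) : R := Re z ^+ 2 + Im z ^+ 2.

Lemma normsq_ge0 z : 0 <= normsq z. Proof. by rewrite addr_ge0 // sqr_ge0. Qed.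

Lemma normsq_eq0 z : (normsq z == 0) = (z == 0).
Proof.
rewrite /normsq paddr_eq0 ?sqr_ge0 // !sqrf_eq0; apply/andP/eqP => [[/eqP a /eqP b]|->//].
exact: complex_ext.
Qed.

Lemma normsq0 : normsq 0 = 0. Proof. by apply/eqP; rewrite normsq_eq0. Qed.

Lemma normsq_gt0 z : (0 < normsq z) = (z != 0).
Proof. by rewrite lt_neqAle normsq_ge0 andbT eq_sym normsq_eq0. Qed.

Lemma normsqM x y : normsq (x * y) = normsq x * normsq y.
Proof. by rewrite /normsq !ReImE; ring. Qed.

Lemma normsqN x : normsq (- x) = normsq x.
Proof. by rewrite /normsq !ReImE; ring. Qed.

Lemma normsqJ x : normsq (conjc x) = normsq x.
Proof. by rewrite /normsq !ReImE; ring. Qed.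

Lemma normsqR (a : R) : normsq a%:C = a ^+ 2.
Proof. by rewrite /normsq /= expr0n addr0. Qed.

(** The gap is [normsq (x - y)], by the parallelogram law. Most factors 2 and 4 in later estimates
    come from here. *)
Lemma normsqD x y : normsq (x + y) <= 2 * normsq x + 2 * normsq y.
Proof.
rewrite /normsq !ReImE -subr_ge0.
rewrite (_ : _ - _ = (Re x - Re y) ^+ 2 + (Im x - Im y) ^+ 2); last by ring.
by rewrite addr_ge0 // sqr_ge0.
Qed.

Lemma normsq_Re z : Re z ^+ 2 <= normsq z. Proof. by rewrite lerDl sqr_ge0. Qed.
Lemma normsq_Im z : Im z ^+ 2 <= normsq z. Proof. by rewrite lerDr sqr_ge0. Qed.

Lemma conjcD x y : conjc (x + y) = conjc x + conjc y.
Proof. by apply: complex_ext; rewrite !ReImE // opprD. Qed.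

Lemma conjcB x y : conjc (x - y) = conjc x - conjc y.
Proof. by apply: complex_ext; rewrite !ReImE // opprD. Qed.

Lemma conjcM x y : conjc (x * y) = conjc x * conjc y.
Proof. by apply: complex_ext; rewrite !ReImE; ring. Qed.

Lemma mul_conj_normsq z : z * conjc z = (normsq z)%:C.
Proof. by apply: complex_ext; rewrite !ReImE /normsq /=; ring. Qed.

End complex_numbers.

(* Convertible to [cintegral `[0, t] f]. *)
Definition cprim (R : realType) (f : R -> R[i]) (t : R) : R[i] :=
  prim (fun x => complex.Re (f x)) t +i* prim (fun x => complex.Im (f x)) t.

Definition ccont (R : realType) (e : \bar R) (f : R -> R[i]) : Prop :=
  econt e (fun x => complex.Re (f x)) /\ econt e (fun x => complex.Im (f x)).

Definition intsq (R : realType) (f : R -> R[i]) (t : R) : R := prim (fun x => normsq (f x)) t.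

Section complex_layer.
Context {R : realType} (e : \bar R).
Implicit Types (f g : R -> R[i]) (s t T : R).
Local Notation Re := complex.Re.
Local Notation Im := complex.Im.

Lemma ccont_L1loc f : ccont e f -> L1loc e f.
Proof. by case=> a b; split; exact: econt_L1loc. Qed.

Lemma eq_ccont f g : (forall x, edge e x -> f x = g x) -> ccont e f -> ccont e g.
Proof.
by move=> fg [a b]; split; [move: a|move: b]; apply: eq_econt => x ex; rewrite fg.
Qed.

Lemma eq_L1loc f g : (forall x, edge e x -> f x = g x) -> L1loc e f -> L1loc e g.
Proof.
by move=> fg [a b]; split; [move: a|move: b]; apply: eq_L1loc_real => x ex; rewrite fg.
Qed.

Lemma ccont_cst (z : R[i]) : ccont e (fun=> z).
Proof. by split; exact: econt_cst. Qed.

Lemma ccontD f g : ccont e f -> ccont e g -> ccont e (fun x => f x + g x).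
Proof.
move=> [a b] [c d]; split.
  by apply: eq_econt (econtD a c) => x _; rewrite ReImE.
by apply: eq_econt (econtD b d) => x _; rewrite ReImE.
Qed.

Lemma ccontN f : ccont e f -> ccont e (fun x => - f x).
Proof.
move=> [a b]; split.
  by apply: eq_econt (econtN a) => x _; rewrite ReImE.
by apply: eq_econt (econtN b) => x _; rewrite ReImE.
Qed.

Lemma ccontM f g : ccont e f -> ccont e g -> ccont e (fun x => f x * g x).
Proof.
move=> [a b] [c d]; split.
  by apply: eq_econt (econtB (econtM a c) (econtM b d)) => x _; rewrite !ReImE.
by apply: eq_econt (econtD (econtM a d) (econtM b c)) => x _; rewrite !ReImE.
Qed.

Lemma ccontJ f : ccont e f -> ccont e (fun x => conjc (f x)).
Proof.
move=> [a b]; split; first by apply: eq_econt a => x _; rewrite ReImE.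
by apply: eq_econt (econtN b) => x _; rewrite ReImE.
Qed.

Lemma econt_normsq f : ccont e f -> econt e (fun x => normsq (f x)).
Proof.
move=> [a b]; apply: eq_econt (econtD (econtM a a) (econtM b b)) => x _.
by rewrite /normsq !expr2.
Qed.

Lemma L1locD f g : L1loc e f -> L1loc e g -> L1loc e (fun x => f x + g x).
Proof.
move=> [a b] [c d]; split.
  by apply: eq_L1loc_real (L1loc_realD a c) => x _; rewrite ReImE.
by apply: eq_L1loc_real (L1loc_realD b d) => x _; rewrite ReImE.
Qed.

Lemma L1locN f : L1loc e f -> L1loc e (fun x => - f x).
Proof.
move=> [a b]; split.
  by apply: eq_L1loc_real (L1loc_realN a) => x _; rewrite ReImE.
by apply: eq_L1loc_real (L1loc_realN b) => x _; rewrite ReImE.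
Qed.

Lemma L1locM f g : ccont e f -> L1loc e g -> L1loc e (fun x => f x * g x).
Proof.
move=> [a b] [c d]; split.
  by apply: eq_L1loc_real (L1loc_realB (L1loc_realM a c) (L1loc_realM b d)) => x _; rewrite !ReImE.
by apply: eq_L1loc_real (L1loc_realD (L1loc_realM a d) (L1loc_realM b c)) => x _; rewrite !ReImE.
Qed.

Lemma L1locZ (z : R[i]) f : L1loc e f -> L1loc e (fun x => z * f x).
Proof. by apply: L1locM; exact: ccont_cst. Qed.

Lemma eq_cprim f g t : (forall x, 0 <= x -> x <= t -> f x = g x) ->
  cprim f t = cprim g t.
Proof.
by move=> fg; apply: complex_ext; apply: eq_prim => x x0 xt; rewrite fg.
Qed.

Lemma cprim0 f : cprim f 0 = 0.
Proof. by rewrite /cprim !prim0. Qed.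

Lemma cprimD f g t : edge e t -> L1loc e f -> L1loc e g ->
  cprim (fun x => f x + g x) t = cprim f t + cprim g t.
Proof.
move=> et [a b] [c d]; apply: complex_ext; rewrite ReImE /= -(primD et) //;
  by apply: eq_prim => x _ _; rewrite ReImE.
Qed.

Lemma cprimN f t : edge e t -> L1loc e f -> cprim (fun x => - f x) t = - cprim f t.
Proof.
move=> et [a b]; apply: complex_ext; rewrite ReImE /= -(primN et) //;
  by apply: eq_prim => x _ _; rewrite ReImE.
Qed.

Lemma cprimB f g t : edge e t -> L1loc e f -> L1loc e g ->
  cprim (fun x => f x - g x) t = cprim f t - cprim g t.
Proof.
by move=> et Lf Lg; rewrite (cprimD et Lf (L1locN Lg)) (cprimN et).
Qed.

Lemma cprimZ (z : R[i]) f t : edge e t -> L1loc e f ->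
  cprim (fun x => z * f x) t = z * cprim f t.
Proof.
move=> et [a b]; apply: complex_ext; rewrite !ReImE /= -!(primZ _ et) //.
  rewrite -(primB et); try exact: L1loc_realZ.
  by apply: eq_prim => x _ _; rewrite !ReImE.
rewrite -(primD et); try exact: L1loc_realZ.
by apply: eq_prim => x _ _; rewrite !ReImE.
Qed.

Lemma cprimJ f t : edge e t -> L1loc e f -> cprim (fun x => conjc (f x)) t = conjc (cprim f t).
Proof.
move=> et [a b]; apply: complex_ext; rewrite !ReImE /=.
  by apply: eq_prim => x _ _; rewrite ReImE.
by rewrite -(primN et) //; apply: eq_prim => x _ _; rewrite ReImE.
Qed.

Lemma cprim_cont f : L1loc e f -> ccont e (cprim f).
Proof. by move=> [a b]; split; exact: prim_cont. Qed.

(** The constants [F 0] and [G 0] are split off, and [primM] applies to what remains. *)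
Lemma AC_mul_real (F G f g : R -> R) t : edge e t ->
  L1loc_real e f -> L1loc_real e g -> econt e F -> econt e G ->
  (forall x, edge e x -> F x = F 0 + prim f x) ->
  (forall x, edge e x -> G x = G 0 + prim g x) ->
  F t * G t = F 0 * G 0 + prim (fun x => F x * g x + G x * f x) t.
Proof.
move=> et Lf Lg cF cG eF eG; rewrite eF // eG //.
have LPf := L1loc_realM (prim_cont Lf) Lg; have LPg := L1loc_realM (prim_cont Lg) Lf.
have -> : prim (fun x => F x * g x + G x * f x) t =
   prim (fun x => (F 0 * g x + G 0 * f x) + (prim f x * g x + f x * prim g x)) t.
  apply: eq_prim => x x0 xt; have ex := edge_le x0 xt et.
  by rewrite eF // (eG x) //; ring.
have L3 : L1loc_real e (fun x => prim f x * g x + f x * prim g x).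
  by apply: eq_L1loc_real (L1loc_realD LPf LPg) => x _; congr (_ + _); rewrite mulrC.
rewrite (primD et (L1loc_realD (L1loc_realZ _ Lg) (L1loc_realZ _ Lf)) L3) (primD et (L1loc_realZ _ Lg) (L1loc_realZ _ Lf)).
by rewrite -(primM et) // !(primZ _ et) //; ring.
Qed.

Lemma AC_mul (F G f g : R -> R[i]) t : edge e t ->
  L1loc e f -> L1loc e g -> ccont e F -> ccont e G ->
  (forall x, edge e x -> F x = F 0 + cprim f x) ->
  (forall x, edge e x -> G x = G 0 + cprim g x) ->
  F t * G t = F 0 * G 0 + cprim (fun x => F x * g x + G x * f x) t.
Proof.
move=> et [Lf1 Lf2] [Lg1 Lg2] [F1 F2] [G1 G2] eF eG.
have eF1 x : edge e x -> Re (F x) = Re (F 0) + prim (fun y => Re (f y)) x.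
  by move=> /eF ->; rewrite ReImE.
have eF2 x : edge e x -> Im (F x) = Im (F 0) + prim (fun y => Im (f y)) x.
  by move=> /eF ->; rewrite ReImE.
have eG1 x : edge e x -> Re (G x) = Re (G 0) + prim (fun y => Re (g y)) x.
  by move=> /eG ->; rewrite ReImE.
have eG2 x : edge e x -> Im (G x) = Im (G 0) + prim (fun y => Im (g y)) x.
  by move=> /eG ->; rewrite ReImE.
have L (F' G' f' g' : R -> R) : L1loc_real e f' -> L1loc_real e g' -> econt e F' -> econt e G' ->
  L1loc_real e (fun x => F' x * g' x + G' x * f' x).
  by move=> *; apply: L1loc_realD; exact: L1loc_realM.
apply: complex_ext; rewrite !ReImE /=.
  rewrite (AC_mul_real et Lf1 Lg1 F1 G1) // (AC_mul_real et Lf2 Lg2 F2 G2) //.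
  rewrite opprD addrACA; congr (_ + _); rewrite -(primB et); try exact: L.
  by apply: eq_prim => x _ _; rewrite !ReImE; ring.
rewrite (AC_mul_real et Lf1 Lg2 F1 G2) // (AC_mul_real et Lf2 Lg1 F2 G1) //.
rewrite addrACA; congr (_ + _); rewrite -(primD et); try exact: L.
by apply: eq_prim => x _ _; rewrite !ReImE; ring.
Qed.

Lemma intsq_ge0 f t : 0 <= intsq f t.
Proof. by apply: prim_ge0 => x _ _; exact: normsq_ge0. Qed.

Lemma intsq_homo f s t : edge e t -> 0 <= s -> s <= t -> ccont e f -> intsq f s <= intsq f t.
Proof.
move=> et s0 st cf; apply: (prim_homo et) => //; first exact/econt_L1loc/econt_normsq.
by move=> x _ _; exact: normsq_ge0.
Qed.

Lemma intsqD f g t : edge e t -> ccont e f -> ccont e g ->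
  intsq (fun x => f x + g x) t <= 2 * intsq f t + 2 * intsq g t.
Proof.
move=> et cf cg; have Lf := econt_L1loc (econt_normsq cf); have Lg := econt_L1loc (econt_normsq cg).
rewrite /intsq -!(primZ _ et) // -(primD et); try exact: L1loc_realZ.
apply: (ler_prim0 et).
- exact/econt_L1loc/econt_normsq/ccontD.
- by apply: L1loc_realD; exact: L1loc_realZ.
- by move=> x _ _; exact: normsqD.
Qed.

(** The quadratic arises as the integral of [|conj f - k conj J g|^2] with [J] the integral of [f g]
    and [D = |J|^2]; its value at the minimum [k = 1 / B] gives the claim. *)
Lemma discriminant (A B D : R) : 0 <= A -> 0 <= B -> 0 <= D ->
  (forall k, 0 <= A - 2 * k * D + k ^+ 2 * D * B) -> D <= A * B.
Proof.
move=> A0 B0; rewrite le_eqVlt => /predU1P[<- _|D0 H]; first exact: mulr_ge0.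
move: B0; rewrite le_eqVlt => /predU1P[B0|B0].
  (* For [B = 0] the polynomial is affine in [k], and this [k] would give it the value -1. *)
  have := H ((A + 1) / (2 * D)); rewrite -B0 mulr0 addr0.
  rewrite (_ : A - _ = -1); first by rewrite oppr_ge0 ler10.
  by field; rewrite gt_eqF.
have := H B^-1.
rewrite (_ : _ + _ = A - D / B); last by field; rewrite gt_eqF.
by rewrite subr_ge0 ler_pdivrMr.
Qed.

Lemma cauchy_schwarz f g s t : edge e t -> 0 <= s -> s <= t ->
  ccont e f -> ccont e g ->
  normsq (cprim (fun x => f x * g x) t - cprim (fun x => f x * g x) s) <=
  (intsq f t - intsq f s) * (intsq g t - intsq g s).
Proof.
move=> et s0 st cf cg; have es := edge_le s0 st et.
have Nf := econt_L1loc (econt_normsq cf); have Ng := econt_L1loc (econt_normsq cg).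
have cfg := ccontM cf cg; have Lfg := ccont_L1loc cfg.
set J := cprim _ t - cprim _ s.
apply: discriminant; rewrite ?subr_ge0 ?(intsq_homo et) ?normsq_ge0 // => k.
pose z := k%:C * conjc J.
have := ler_prim et s0 st (L1loc_real_cst 0)
  (econt_L1loc (econt_normsq (ccontD (ccontJ cf) (ccontN (ccontM (ccont_cst z) cg))))).
rewrite !prim_cst ?mul0r ?subrr //; last exact: le_trans s0 st.
move=> /(_ (fun _ _ _ => normsq_ge0 _)).
have split r : edge e r ->
  prim (fun x => normsq (conjc (f x) + - (z * g x))) r =
  intsq f r - 2 * Re (z * cprim (fun x => f x * g x) r) + normsq z * intsq g r.
  move=> er; rewrite -(cprimZ z er Lfg) /= /intsq.
  have Lz := L1locZ z Lfg; have [Lz1 _] := Lz.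
  rewrite -!(primZ _ er) // -(primB er) //; last exact: L1loc_realZ.
  rewrite -(primD er); [|exact: L1loc_realB Nf (L1loc_realZ _ Lz1)|exact: L1loc_realZ].
  by apply: eq_prim => x _ _; rewrite /normsq !ReImE; ring.
rewrite !split // => /le_trans; apply; rewrite le_eqVlt; apply/orP; left; apply/eqP.
have -> : normsq z = k ^+ 2 * normsq J by rewrite normsqM normsqJ normsqR.
have zJ : Re (z * J) = k * normsq J.
  by rewrite /z -mulrA [conjc _ * _]mulrC mul_conj_normsq -rmorphM.
have zJ' : Re (z * J) = Re (z * cprim (fun x => f x * g x) t) -
    Re (z * cprim (fun x => f x * g x) s) by rewrite -ReN -ReD -mulrBr.
by rewrite -[2 * k * _]mulrA -zJ zJ'; ring.
Qed.

End complex_layer.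

(** * Limits at the endpoint and square integrability *)

Section limits.
Context {R : realType}.

Lemma normc_lt (z : R[i]) (r : R) : 0 < r -> (`|z| < r%:C) = (normsq z < r ^+ 2).
Proof.
move=> r0; rewrite normc_def ltcR -/(normsq z).
by rewrite -[X in _ < X = _](gtr0_norm r0) -sqrtr_sqr ltr_sqrt // exprn_gt0.
Qed.

Lemma cvg_normsqP (T : Type) (F : set_system T) (FF : Filter F) (f : T -> R[i]) (l : R[i]) :
  ((f : T -> Cplx R) @ F --> (l : Cplx R)) <->
  (forall d : R, 0 < d -> \forall t \near F, normsq (f t - l) < d).
Proof.
split => [/cvgrPdist_lt H d d0|H].
  have s0 : 0 < Num.sqrt d by rewrite sqrtr_gt0.
  have := H (Num.sqrt d)%:C; rewrite ltcR => /(_ s0); apply: filterS => t.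
  by rewrite distrC normc_lt // sqr_sqrtr // ltW.
apply/cvgrPdist_lt => -[r i]; rewrite ltcE /= => /andP[/eqP -> r0].
have := H (r ^+ 2) (exprn_gt0 2 r0); apply: filterS => t.
by rewrite distrC [Complex r 0]complexr0 normc_lt.
Qed.

Lemma at_rightP (P : R -> Prop) :
  (\forall t \near 0^'+, P t) <-> exists2 d : R, 0 < d & forall t, 0 < t -> t < d -> P t.
Proof.
split=> [[d /= d0 H]|[d d0 H]].
  exists d => // t t0 td; apply: H => //=.
  by rewrite sub0r normrN gtr0_norm.
near=> t; apply: H; near: t; [exact: nbhs_right_gt|exact: nbhs_right_lt].
Unshelve. all: by end_near. Qed.

Lemma at_endP (e : \bar R) (P : R -> Prop) : (0%:E < e)%E ->
  (\forall t \near at_end e, P t) <->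
  exists2 a : R, edge e a & forall t, edge e t -> a <= t -> P t.
Proof.
case: e => [r| |//] e0; rewrite /at_end.
  rewrite lte_fin in e0.
  split=> [[d /= d0 H]|[a [a0 ar] H]].
    exists (Num.max 0 (r - d / 2)).
      split; first by rewrite le_max lexx.
      by rewrite lte_fin gt_max e0 ltrBlDr ltrDl divr_gt0.
    move=> t [t0]; rewrite lte_fin => tr; rewrite ge_max => /andP[_ dt].
    apply: H => //=; rewrite gtr0_norm ?subr_gt0 //.
    by move: dt d0; lra.
  rewrite lte_fin in ar.
  near=> t; apply: H.
    split; last by rewrite lte_fin; near: t; exact: nbhs_left_lt.
    by near: t; exact: nbhs_left_ge.
  by near: t; exact: nbhs_left_ge.
split=> [[M [Mr H]]|[a [a0 _] H]].
  exists (Num.max 0 (M + 1)); first by split; rewrite ?ltry // le_max lexx.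
  move=> t _; rewrite ge_max => /andP[_ Mt]; apply: H.
  by move: Mt; lra.
exists a; split; first exact: num_real.
by move=> t at_; apply: H; [split; [exact: le_trans (ltW at_)|rewrite ltry]|exact: ltW].
Unshelve. all: by end_near. Qed.

#[global] Instance at_end_filter (e : \bar R) : Filter (at_end e).
Proof. by case: e => [r| |]; rewrite /at_end; typeclasses eauto. Qed.

(** Convergence to zero at the endpoint; a threshold [a] inside the edge treats finite and infinite
    endpoints alike. *)
Definition vanishes (e : \bar R) (f : R -> R[i]) : Prop :=
  forall d : R, 0 < d -> exists2 a, edge e a &
    forall t, edge e t -> a <= t -> normsq (f t) < d.

Lemma vanishesP (e : \bar R) (f : R -> R[i]) : (0%:E < e)%E ->
  ((f : R -> Cplx R) @ at_end e --> (0 : Cplx R)) <-> vanishes e f.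
Proof.
move=> e0; rewrite cvg_normsqP; split => H d d0.
  have /(at_endP _ e0)[a ea Ha] := H d d0.
  by exists a => // t et at_; have := Ha t et at_; rewrite subr0.
apply/(at_endP _ e0); have [a ea Ha] := H d d0.
by exists a => // t et at_; rewrite subr0; exact: Ha.
Qed.

End limits.

Section square_integrable.
Context {R : realType} (e : \bar R).
Implicit Types (f g u : R -> R[i]).

Lemma edge0 : (0%:E < e)%E -> edge e (0 : R).
Proof. by move=> e0; split. Qed.

Lemma measurable_edge : measurable (edge e).
Proof.
case: e => [r| |]; rewrite /edge.
- rewrite (_ : [set x | _] = `[0, r[%classic) //.
  apply/seteqP; split => x /=; rewrite in_itv /= lte_fin; first by case=> -> ->.
  by case/andP.
- rewrite (_ : [set x | _] = `[0, +oo[%classic) //.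
  apply/seteqP; split => x /=; rewrite in_itv /= andbT; first by case.
  by move=> x0; rewrite ltry.
- rewrite (_ : [set x | _] = set0) //.
  by apply/seteqP; split => x //= [].
Qed.

Lemma edge_exhaustion : (0%:E < e)%E -> exists T : nat -> R,
  [/\ forall n, edge e (T n), {homo T : n k / (n <= k)%N >-> n <= k} &
      forall x, edge e x -> exists n, x <= T n].
Proof.
case: e => [r| |//] e0.
  rewrite lte_fin in e0.
  exists (fun n => r - r / n.+1%:R); split.
  - move=> n; split; last by rewrite lte_fin ltrBlDr ltrDl divr_gt0.
    by rewrite subr_ge0 ler_pdivrMr // -{1}[r]mulr1 ler_pM2l // ler1n.
  - move=> n k nk; rewrite lerD2l lerN2 ler_pM2l // lef_pV2 ?posrE //.
    by rewrite ler_nat.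
  - move=> x [x0]; rewrite lte_fin => xr.
    have rx : 0 < r - x by rewrite subr_gt0.
    exists (Num.bound (r / (r - x))).
    rewrite lerBrDl -lerBrDr ler_pdivrMr // mulrC -ler_pdivrMr //.
    have := archi_boundP (ltW (divr_gt0 e0 rx)) => /ltW /le_trans; apply.
    by rewrite ler_nat.
exists (fun n => n%:R); split.
- by move=> n; split; rewrite ?ltry.
- by move=> n k nk; rewrite ler_nat.
- by move=> x [x0 _]; exists (Num.bound x); exact/ltW/archi_boundP.
Qed.

Definition L2bounded f := exists C : R, forall t, edge e t -> intsq f t <= C.

(** Monotone convergence along an exhausting sequence of intervals. From here on square
    integrability is a statement about the truncated integrals [intsq f t]. *)
Lemma L2_bounded f : (0%:E < e)%E -> ccont e f -> L2 e f <-> L2bounded f.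
Proof.
move=> e0 cf; have Ln := econt_L1loc (econt_normsq cf).
have N2E t : edge e t ->
    (\int[leb R]_(x in `[0%R, t]) (normsq (f x))%:E = (intsq f t)%:E)%E.
  by move=> et; rewrite -EFin_Rintegral //; exact: Ln.
have mn t : edge e t -> measurable_fun (`[0, t]%classic : set R) (fun x => (normsq (f x))%:E).
  by move=> et; exact: (measurable_int _ (Ln t et)).
have [T [eT Tm Tex]] := edge_exhaustion e0.
have UT : edge e = \bigcup_n `[0, T n]%classic.
  apply/seteqP; split=> x /=.
    by move=> ex; have [n xn] := Tex x ex; exists n => //=; rewrite in_itv /= xn (edge_ge0 ex).
  by move=> [n _] /=; rewrite in_itv /= => /andP[x0 xn]; exact: edge_le (eT n).
have mbig (h : R -> R) : econt e h -> measurable_fun (edge e) h.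
  move=> ch; rewrite UT; apply/measurable_fun_bigcup => // n.
  exact: subspace_continuous_measurable_fun (ch _ (eT n)).
have mne : measurable_fun (edge e) (fun x => (normsq (f x))%:E).
  by apply/measurable_EFinP; apply: mbig; exact: econt_normsq.
split=> [[_ _ H]|[C HC]].
  have I0 : (0 <= \int[leb R]_(x in edge e) (normsq (f x))%:E)%E.
    by apply: integral_ge0 => x _; rewrite lee_fin normsq_ge0.
  exists (fine (\int[leb R]_(x in edge e) (normsq (f x))%:E)) => t et.
  rewrite -lee_fin -N2E // fineK; last by rewrite ge0_fin_numE.
  apply: ge0_subset_integral => //.
  - exact: measurable_edge.
  - by move=> x _; rewrite lee_fin normsq_ge0.
  - by move=> x /=; rewrite in_itv /= => /andP[x0 xt]; exact: edge_le et.
split; [exact: mbig (proj1 cf)|exact: mbig (proj2 cf)|].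
apply: (@le_lt_trans _ _ C%:E); last by rewrite ltry.
rewrite UT.
have cvgT : (\int[leb R]_(x in `[0%R, T i]) (normsq (f x))%:E)%E @[i --> \oo] -->
    (\int[leb R]_(x in \bigcup_i `[0%R, T i]%classic) (normsq (f x))%:E)%E.
  apply: ge0_nondecreasing_set_cvg_integral => //.
  - by move=> n k nk; apply/subsetPset/subset_itv; rewrite bnd_simp // Tm.
  - by move=> n; exact: mn (eT n).
  - by move=> n x _; rewrite lee_fin normsq_ge0.
apply: (cvge_to_le cvgT).
by apply: nearW => n; rewrite N2E // lee_fin; exact: HC.
Qed.

End square_integrable.

(** * Solutions and Wronskians *)

(* Pairs (u, u') of a function and its derivative. *)
Definition cpair (R : realType) := ((R -> R[i]) * (R -> R[i]))%type.

(** The differential equation as an integrated first-order system: its identities hold at every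
    point of the edge, so the exceptional null set in [sl_expr] is dealt with once, in the passage
    from [sl_solution]. *)
Definition sol (R : realType) (e : \bar R) (q : R -> R) (z : R[i]) (U : cpair R) :=
  [/\ ccont e U.1, ccont e U.2,
      forall t, edge e t -> U.1 t = U.1 0 + cprim U.2 t &
      forall t, edge e t -> U.2 t = U.2 0 + cprim (fun x => ((q x)%:C - z) * U.1 x) t].

Definition wr (R : realType) (U V : cpair R) (t : R) : R[i] :=
  U.1 t * V.2 t - U.2 t * V.1 t.

Section solutions.
Context {R : realType} (e : \bar R) (q : R -> R).
Hypothesis Lq : L1loc_real e q.
Implicit Types (z : R[i]) (U V Y : cpair R).
Local Notation sol := (sol e q).
Local Notation Re := complex.Re.
Local Notation Im := complex.Im.

Lemma L1loc_pot z : L1loc e (fun x => (q x)%:C - z).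
Proof.
split; first by apply: eq_L1loc_real (L1loc_realB Lq (L1loc_real_cst (Re z))) => x _; rewrite !ReImE.
by apply: eq_L1loc_real (L1loc_real_cst (- Im z)) => x _; rewrite !ReImE /= add0r.
Qed.

Lemma L1loc_potM z (f : R -> R[i]) : ccont e f -> L1loc e (fun x => ((q x)%:C - z) * f x).
Proof.
by move=> cf; apply: eq_L1loc (L1locM cf (L1loc_pot z)) => x _; rewrite mulrC.
Qed.

Lemma sol_of_sl z (u du : R -> R[i]) : sl_solution e q z u du -> sol z (u, du).
Proof.
move=> [[Ldu eu] [ddu [Lddu edu] H]].
have Ldu' : L1loc e du by [].
have cu : ccont e u.
  by apply: eq_ccont (ccontD (ccont_cst e (u 0)) (cprim_cont Ldu')) => x /eu ->.
have cdu : ccont e du.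
  by apply: eq_ccont (ccontD (ccont_cst e (du 0)) (cprim_cont Lddu)) => x /edu ->.
split => // t et; rewrite /= edu //; congr (_ + _).
have [a b] := L1loc_potM z cu; have [c d] := Lddu.
have E : {ae leb R, forall x, edge e x -> ddu x = ((q x)%:C - z) * u x}.
  case: H => N [mN N0 HN]; exists N; split => //; apply: subset_trans HN.
  apply: subsetC => x /= Hx ex; have := Hx ex => Hx'.
  rewrite mulrBl -[z * u x]/(z * u x : Cplx R) Hx' /=.
  by rewrite opprD opprK addrCA subrr addr0.
apply: complex_ext; apply: (prim_ae et) => //.
  by case: E => N [mN N0 HN]; exists N; split => //; apply: subset_trans HN;
    apply: subsetC => x /= Hx /Hx ->.
by case: E => N [mN N0 HN]; exists N; split => //; apply: subset_trans HN;
  apply: subsetC => x /= Hx /Hx ->.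
Qed.

Lemma sl_of_sol z U : sol z U -> sl_solution e q z U.1 U.2.
Proof.
move=> [cu cdu eu edu]; split; first by split; [exact: ccont_L1loc|].
exists (fun x => ((q x)%:C - z) * U.1 x); first by split; [exact: L1loc_potM|].
apply: aeW => x _; rewrite mulrBl.
by rewrite opprB addrNK.
Qed.

Lemma solZ z (c : R[i]) U : sol z U -> sol z (fun x => c * U.1 x, fun x => c * U.2 x).
Proof.
move=> [cu cdu eu edu]; split => /=; try by [exact: ccontM (ccont_cst e c) _].
  by move=> t et; rewrite (cprimZ c et (ccont_L1loc cdu)) -mulrDr -eu.
move=> t et; rewrite edu // mulrDr -(cprimZ c et (L1loc_potM z cu)).
by congr (_ + _); apply: eq_cprim => x _ _; ring.
Qed.

Lemma solJ z U : sol z U -> sol (conjc z) (fun x => conjc (U.1 x), fun x => conjc (U.2 x)).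
Proof.
move=> [cu cdu eu edu]; split => /=; try exact: ccontJ.
  by move=> t et; rewrite (cprimJ et (ccont_L1loc cdu)) -conjcD -eu.
move=> t et; rewrite edu // conjcD -(cprimJ et (L1loc_potM z cu)).
congr (_ + _); apply: eq_cprim => x _ _; by rewrite conjcM conjcB conjc_real.
Qed.

(** The product rule for [U.1 * V.2] and for [U.2 * V.1]; in the difference the terms [U.2 * V.2]
    and those containing [q] cancel. *)
Lemma lagrange_identity z1 z2 U V t : sol z1 U -> sol z2 V -> edge e t ->
  wr U V t = wr U V 0 + (z1 - z2) * cprim (fun x => U.1 x * V.1 x) t.
Proof.
move=> [cu cdu eu edu] [cv cdv ev edv] et.
rewrite /wr.
rewrite (AC_mul et (ccont_L1loc cdu) (L1loc_potM z2 cv) cu cdv eu edv).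
rewrite (AC_mul et (L1loc_potM z1 cu) (ccont_L1loc cdv) cdu cv edu ev).
rewrite opprD addrACA; congr (_ + _).
have L1 := L1locM cu (L1loc_potM z2 cv); have L2 := L1locM cv (L1loc_potM z1 cu).
have Ldd := ccont_L1loc (ccontM cdu cdv); have Luv := ccont_L1loc (ccontM cu cv).
have Ldd' := ccont_L1loc (ccontM cdv cdu).
rewrite -(cprimB et (L1locD L1 Ldd') (L1locD Ldd L2)) -(cprimZ _ et Luv).
by apply: eq_cprim => x _ _; ring.
Qed.

Lemma lagrange_identityB z1 z2 U V s t : sol z1 U -> sol z2 V -> edge e t -> edge e s ->
  wr U V t - wr U V s = (z1 - z2) * (cprim (fun x => U.1 x * V.1 x) t -
                                     cprim (fun x => U.1 x * V.1 x) s).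
Proof.
move=> sU sV et es; rewrite (lagrange_identity sU sV et) (lagrange_identity sU sV es).
by rewrite opprD addrACA subrr add0r mulrBr.
Qed.

Lemma wronskian_const z U V t : sol z U -> sol z V -> edge e t -> wr U V t = wr U V 0.
Proof. by move=> sU sV et; rewrite (lagrange_identity sU sV et) subrr mul0r addr0. Qed.

Lemma real_sol_exists (x a b : R) : exists U : cpair R,
  [/\ sol x%:C U, U.1 0 = a%:C & U.2 0 = b%:C].
Proof.
have LQ : L1loc_real e (fun t => q t - x) by exact: L1loc_realB Lq (L1loc_real_cst x).
have [u [du [cu cdu eu edu]]] := linear_system_sol a b LQ.
(* If 0 is not in the edge, then the edge is empty and all conditions are void. *)
have [e0|e0] := pselect (edge e (0 : R)); last first.
  exists (fun=> a%:C, fun=> b%:C); split => //; split; try exact: ccont_cst;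
    by move=> t et; case: e0; exact: edge_le (lexx 0) (edge_ge0 et) et.
have u0 : u 0 = a by rewrite eu // prim0 addr0.
have du0 : du 0 = b by rewrite edu // prim0 addr0.
exists (fun t => (u t)%:C, fun t => (du t)%:C); split; rewrite /= ?u0 ?du0 //.
split => /=.
- by split => //; exact: econt_cst.
- by split => //; exact: econt_cst.
- move=> t et; have t0 := edge_ge0 et.
  apply: complex_ext; rewrite ReImE /=; first by rewrite u0 eu.
  by rewrite add0r prim_cst // mul0r.
- move=> t et; have t0 := edge_ge0 et.
  apply: complex_ext; rewrite ReImE /=.
    rewrite du0 edu //; congr (_ + _); apply: eq_prim => y _ _.
    by rewrite /= ?ReImE /=; ring.
  rewrite (@eq_prim _ _ (fun=> 0)) ?prim_cst ?mul0r ?add0r // => y _ _.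
  by rewrite /= ?ReImE /=; ring.
Qed.

(** Cramer's rule: [Y] is expanded in [U] and [V] as vectors of the plane, and the first component
    is read off. *)
Lemma plucker3 U V Y t : Y.1 t * wr U V t = U.1 t * wr Y V t - V.1 t * wr Y U t.
Proof. by rewrite /wr; ring. Qed.

(** The Pluecker relation for four vectors of the plane. It recovers the Wronskian of [U] and [V]
    from their Wronskians with a fundamental system [W], [Y]. *)
Lemma plucker4 (U V W Y : cpair R) t :
  wr U V t * wr W Y t = wr U W t * wr V Y t - wr U Y t * wr V W t.
Proof. by rewrite /wr; ring. Qed.

(* By expansion in the fundamental system of real solutions at x. *)
Lemma sol_unique (x : R) U V : sol x%:C U -> sol x%:C V ->
  U.1 0 = V.1 0 -> U.2 0 = V.2 0 ->
  forall t, edge e t -> U.1 t = V.1 t.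
Proof.
move=> sU sV h1 h2 t et.
have [C [sC C1 C2]] := real_sol_exists x 1 0.
have [S [sS S1 S2]] := real_sol_exists x 0 1.
have CS : wr C S t = 1.
  by rewrite (wronskian_const sC sS et) /wr C1 C2 S1 S2 mulr1 mul0r subr0.
have E Y : sol x%:C Y -> Y.1 t = C.1 t * wr Y S 0 - S.1 t * wr Y C 0.
  move=> sY; rewrite -(wronskian_const sY sS et) -(wronskian_const sY sC et).
  by rewrite -plucker3 CS mulr1.
by rewrite (E U) // (E V) // /wr h1 h2.
Qed.

End solutions.

(** * Continuous functions with vanishing integrals *)

Section vanishing_functions.
Context {R : realType} (e : \bar R).

Lemma edge_succ t : edge e t -> exists2 s : R, t < s & edge e s.
Proof.
move=> [t0]; case: e => [r| |//].
  rewrite lte_fin => tr; exists ((t + r) / 2); first by lra.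
  by split; [|rewrite lte_fin]; lra.
by move=> _; exists (t + 1); [lra|split; [lra|rewrite ltry]].
Qed.

Lemma econt_right (f : R -> R) t : econt e f -> edge e t -> forall d : R, 0 < d ->
  exists s : R, [/\ t < s, edge e s & forall x, t <= x -> x <= s -> `|f x - f t| < d].
Proof.
move=> cf et d d0; have [s0 ts es0] := edge_succ et.
have t0s : `[0, s0]%classic t by rewrite /= in_itv /= (edge_ge0 et) ltW.
have cft : f @ nbhs_subspace (t : subspace `[0, s0]) --> f t by exact: (cf _ es0 t).
rewrite -(nbhs_subspace_in t0s) in cft.
have := cft => /cvgrPdist_lt /(_ d d0); rewrite near_withinE => -[r /= r0 H].
exists (Num.min s0 (t + r / 2)); split.
- by rewrite lt_min ts ltrDl divr_gt0.
- have [_ s0e] := es0; split.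
    by rewrite le_min (edge_ge0 es0) addr_ge0 ?(edge_ge0 et) // divr_ge0 // ltW.
  by apply: le_lt_trans s0e; rewrite lee_fin ge_min lexx.
- move=> x tx; rewrite le_min => /andP[xs xr]; rewrite distrC; apply: H => /=.
    by rewrite distrC ger0_norm ?subr_ge0 //; lra.
  by rewrite in_itv /= xs andbT (le_trans (edge_ge0 et)).
Qed.

Lemma prim_gt0 (f : R -> R) t : econt e f -> (forall x, edge e x -> 0 <= f x) ->
  edge e t -> 0 < f t -> exists2 s : R, edge e s & 0 < prim f s.
Proof.
move=> cf f0 et ft; have Lf := econt_L1loc cf.
have [|s [ts es fs]] := econt_right cf et (d := f t / 2); first by rewrite divr_gt0.
have t0 := edge_ge0 et; have s0 := edge_ge0 es.
exists s => //.
apply: (@lt_le_trans _ _ (prim f s - prim f t)); last first.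
  by rewrite lerBlDr lerDl prim_ge0 // => x x0 xt; apply: f0; exact: edge_le et.
apply: (@lt_le_trans _ _ (prim (fun=> f t / 2) s - prim (fun=> f t / 2) t)).
  by rewrite !prim_cst // -mulrBr mulr_gt0 ?subr_gt0 // divr_gt0.
apply: (ler_prim es) => //; [exact: ltW|exact: L1loc_real_cst|].
move=> x tx xs; have := fs x tx xs; rewrite ltr_norml => /andP[h _].
by move: h; lra.
Qed.

(** A nonzero value would by continuity make [intsq u] positive at some later point, whereas the
    integrand vanishes almost everywhere. *)
Lemma null_cont (u : R -> R[i]) : ccont e u ->
  {ae leb R, forall x, edge e x -> u x = 0} -> forall x, edge e x -> u x = 0.
Proof.
move=> cu Hu x ex; apply/eqP; apply/negPn/negP; rewrite -normsq_gt0 => ux.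
have [s es] := prim_gt0 (econt_normsq cu) (fun x _ => normsq_ge0 (u x)) ex ux.
rewrite (@prim_ae _ e _ (fun=> 0) s) //.
- by rewrite prim_cst ?mul0r ?ltxx //; exact: edge_ge0 es.
- exact/econt_L1loc/econt_normsq.
- exact: L1loc_real_cst.
- case: Hu => N [mN N0 HN]; exists N; split => //; apply: subset_trans HN.
  by apply: subsetC => y /= Hy /Hy ->; rewrite normsq0.
Qed.

Lemma prim_eq0 (f : R -> R) : econt e f -> (0%:E < e)%E ->
  (forall t, edge e t -> prim f t = 0) -> f 0 = 0.
Proof.
move=> cf e0.
have key (g : R -> R) : econt e g -> (forall t, edge e t -> prim g t = 0) -> ~ 0 < g 0.
  move=> cg H g0; have [|s [ts es gs]] := econt_right cg (edge0 e0) (d := g 0 / 2).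
    by rewrite divr_gt0.
  have := ler_prim0 es (L1loc_real_cst (g 0 / 2)) (econt_L1loc cg).
  rewrite H // prim_cst; last exact: ltW.
  move=> h; have {h} : g 0 / 2 * s <= 0; first apply: h.
    by move=> x x0 xs; have := gs x x0 xs; rewrite ltr_norml => /andP[h _]; move: h; lra.
  by rewrite leNgt pmulr_rgt0 ?divr_gt0 // ts.
move=> H; apply/eqP; rewrite eq_le !leNgt; apply/andP; split; apply/negP.
  exact: key.
rewrite -oppr_gt0; apply: (key (fun x => - f x)); first exact: econtN.
by move=> t et; rewrite (primN et) ?H ?oppr0 //; exact: econt_L1loc.
Qed.

Lemma cprim_eq0 (f : R -> R[i]) : ccont e f -> (0%:E < e)%E ->
  (forall t, edge e t -> cprim f t = 0) -> f 0 = 0.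
Proof.
move=> [c1 c2] e0 H; apply: complex_ext.
  by apply: (prim_eq0 c1 e0) => t et; have := H t et => /(congr1 (@complex.Re R)).
by apply: (prim_eq0 c2 e0) => t et; have := H t et => /(congr1 (@complex.Im R)).
Qed.

End vanishing_functions.

(** * Limit point and limit circle endpoints *)

Section endpoint.
Context {R : realType} (e : \bar R) (q : R -> R).
Hypothesis e0 : (0%:E < e)%E.
Hypothesis Lq : L1loc_real e q.
Implicit Types (z : R[i]) (U V Y : cpair R).
Local Notation sol := (sol e q).

(** [a] is taken where the nondecreasing function [intsq f] is within [d] of its supremum. *)
Lemma tail_small (f : R -> R[i]) (d : R) : ccont e f -> L2bounded e f -> 0 < d ->
  exists2 a, edge e a & forall s t, edge e t -> a <= s -> s <= t -> intsq f t - intsq f s < d.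
Proof.
move=> cf [C HC] d0; pose A := [set intsq f t | t in edge e].
have hA : has_sup A.
  by split; [exists (intsq f 0); exists 0 => //; exact: edge0|exists C => _ [t et <-]; exact: HC].
have [_ [a ea <-] Ha] := sup_adherent d0 hA.
exists a => // s t et as_ st; have a0 := edge_ge0 ea.
have ft : intsq f t <= sup A by apply: sup_upper_bound => //; exists t.
have fs : intsq f a <= intsq f s.
  by apply: (intsq_homo _ a0 as_ cf); exact: edge_le (le_trans a0 as_) st et.
by move: Ha ft fs; lra.
Qed.

Lemma not_vanishes (f : R -> R[i]) : ~ vanishes e f ->
  exists2 d : R, 0 < d & forall a, edge e a -> exists t, [/\ edge e t, a <= t & d <= normsq (f t)].
Proof.
move=> nv; apply: contrapT => H; apply: nv => d d0; apply: contrapT => H2.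
apply: H; exists d => // a ea; apply: contrapT => H3; apply: H2; exists a => // t et at_.
by rewrite ltNge; apply/negP => dt; apply: H3; exists t.
Qed.

Lemma edge_max s t : edge e s -> edge e t -> edge e (Num.max s t).
Proof. by move=> es et; case: (leP s t). Qed.

(** Lagrange's identity followed by Cauchy-Schwarz: a Wronskian hardly moves where one factor has a
    small tail and the other a bounded norm. *)
Lemma wronskian_increment z1 z2 U V s t : sol z1 U -> sol z2 V ->
  edge e t -> 0 <= s -> s <= t ->
  normsq (wr U V t - wr U V s) <=
    normsq (z1 - z2) * ((intsq U.1 t - intsq U.1 s) * (intsq V.1 t - intsq V.1 s)).
Proof.
move=> sU sV et s0 st; have es := edge_le s0 st et.
rewrite (lagrange_identityB Lq sU sV et es) normsqM ler_wpM2l ?normsq_ge0 //.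
by apply: (cauchy_schwarz et s0 st); [case: sU|case: sV].
Qed.

Lemma normsq_le_dist (x y : R[i]) : normsq x <= 2 * normsq y + 2 * normsq (x - y).
Proof. by rewrite -{1}(subrK y x) addrC; apply: le_trans (normsqD _ _) _; rewrite addrC. Qed.

(* Solving the Pluecker identity for Y and integrating, the growth of intsq Y.1
   near the endpoint is absorbed because the tails of U.1 and V.1 are small. *)
Lemma L2bounded_of_wronskian z1 z2 z U V Y :
  sol z1 U -> sol z2 V -> L2bounded e U.1 -> L2bounded e V.1 ->
  ~ vanishes e (wr U V) -> sol z Y -> L2bounded e Y.1.
Proof.
move=> sU sV bU bV /not_vanishes[d d0 Hd] sY.
have cU : ccont e U.1 by case: sU.
have cV : ccont e V.1 by case: sV.
have cY : ccont e Y.1 by case: sY.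
pose k := d / 4; pose M := 2 * (normsq (z - z1) + normsq (z - z2)) + 1.
have k0 : 0 < k by rewrite divr_gt0.
have M0 : 0 < M by have := normsq_ge0 (z - z1); have := normsq_ge0 (z - z2); rewrite /M; lra.
have L0 := normsq_ge0 (z1 - z2).
(* The three bounds yield in turn [h ^+ 2 <= h], an oscillation of W(U, V) of at most [k], and a
   coefficient of at most 1 in the final absorption. *)
pose h := Num.min 1 (Num.min (k / (normsq (z1 - z2) + 1)) (k / (8 * M))).
have h0 : 0 < h.
  have p1 : 0 < normsq (z1 - z2) + 1 by lra.
  have p2 : 0 < 8 * M by rewrite mulr_gt0.
  by rewrite !lt_min ltr01 !divr_gt0.
have hh : h ^+ 2 <= h.
  have hle1 : h <= 1 by rewrite ge_min lexx.
  by rewrite expr2 ler_piMl // ltW.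
have h1 : normsq (z1 - z2) * h ^+ 2 <= k.
  apply: (@le_trans _ _ ((normsq (z1 - z2) + 1) * h)).
    by apply: ler_pM => //; [exact: sqr_ge0|lra].
  rewrite mulrC -ler_pdivlMr; last by lra.
  by rewrite ge_min [X in _ || X]ge_min lexx /= orbT.
have h2 : 8 * M * h ^+ 2 <= k.
  apply: (@le_trans _ _ (8 * M * h)); first by rewrite ler_pM2l // mulr_gt0.
  rewrite mulrC -ler_pdivlMr; last by rewrite mulr_gt0.
  by rewrite ge_min [X in _ || X]ge_min lexx /= !orbT.
have [aU eaU tU] := tail_small cU bU h0; have [aV eaV tV] := tail_small cV bV h0.
pose a := Num.max aU aV.
have ea : edge e a by exact: edge_max.
have a0 := edge_ge0 ea.
have tU' t : edge e t -> a <= t -> 0 <= intsq U.1 t - intsq U.1 a <= h.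
  move=> et at_; rewrite subr_ge0 (intsq_homo et) //=; apply/ltW/tU => //.
  by rewrite le_max lexx.
have tV' t : edge e t -> a <= t -> 0 <= intsq V.1 t - intsq V.1 a <= h.
  move=> et at_; rewrite subr_ge0 (intsq_homo et) //=; apply/ltW/tV => //.
  by rewrite le_max lexx orbT.
(* Some later [t'] has |W(U, V)|^2 at least [d = 4 * k], and moving back to [t] changes W by at most
   [k] in square; [normsq_le_dist] leaves [k]. *)
have wlow t : edge e t -> a <= t -> k <= normsq (wr U V t).
  move=> et at_; have [t' [et' tt' dt']] := Hd t et.
  have t0 := edge_ge0 et.
  have := normsq_le_dist (wr U V t') (wr U V t).
  have := wronskian_increment sU sV et' t0 tt'.
  have : normsq (z1 - z2) * ((intsq U.1 t' - intsq U.1 t) * (intsq V.1 t' - intsq V.1 t)) <= k.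
    apply: le_trans h1; rewrite ler_wpM2l // expr2; apply: ler_pM.
    - by rewrite subr_ge0 (intsq_homo et').
    - by rewrite subr_ge0 (intsq_homo et').
    - by apply/ltW/tU => //; rewrite (le_trans _ at_) // le_max lexx.
    - by apply/ltW/tV => //; rewrite (le_trans _ at_) // le_max lexx orbT.
  by rewrite /k; move: dt'; lra.
pose K := 2 * normsq (wr Y V a) + 2 * normsq (wr Y U a).
have K0 : 0 <= K by have := normsq_ge0 (wr Y V a); have := normsq_ge0 (wr Y U a); rewrite /K; lra.
have main T : edge e T -> a <= T -> intsq Y.1 T - intsq Y.1 a <= 8 * K * h / k.
  move=> eT aT; set D := intsq Y.1 T - intsq Y.1 a.
  have D0 : 0 <= D by rewrite subr_ge0 (intsq_homo eT).
  pose c := 2 / k * (K + M * h * D).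
  have c0 : 0 <= c.
    have MhD : 0 <= M * h * D by rewrite mulr_ge0 // mulr_ge0 // ltW.
    have k2 : 0 <= 2 / k by rewrite divr_ge0 // ltW.
    exact: mulr_ge0 k2 (addr_ge0 K0 MhD).
  (* The Wronskians of [Y] with [U] and [V] are bounded by their values at [a] plus a small multiple
     of the unknown growth [D]. *)
  have wup (V' : cpair R) z' : sol z' V' -> (0 <= intsq V'.1 T - intsq V'.1 a <= h) ->
     2 * normsq (wr Y V' a) <= K -> 2 * normsq (z - z') <= M ->
     forall t, a <= t -> t <= T -> normsq (wr Y V' t) <= K + M * h * D.
    move=> sV' /andP[b1 b2] b3 b4 t at_ tT; have et := edge_le (le_trans a0 at_) tT eT.
    apply: le_trans (normsq_le_dist _ (wr Y V' a)) _; apply: lerD => //.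
    have := wronskian_increment sY sV' et a0 at_.
    have cV' : ccont e V'.1 by case: sV'.
    have i1 : 0 <= intsq Y.1 t - intsq Y.1 a by rewrite subr_ge0 (intsq_homo et).
    have i2 : 0 <= intsq V'.1 t - intsq V'.1 a by rewrite subr_ge0 (intsq_homo et).
    have i3 : intsq Y.1 t - intsq Y.1 a <= D by rewrite lerB // (intsq_homo eT) // (le_trans a0).
    have i4 : intsq V'.1 t - intsq V'.1 a <= h.
      by apply: le_trans b2; rewrite lerB // (intsq_homo eT) // (le_trans a0).
    have i5 : (intsq Y.1 t - intsq Y.1 a) * (intsq V'.1 t - intsq V'.1 a) <= D * h by exact: ler_pM.
    move=> i6; apply: (@le_trans _ _ (2 * normsq (z - z') * (D * h))).
      rewrite -mulrA ler_pM2l //; apply: le_trans i6 _.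
      by rewrite ler_wpM2l ?normsq_ge0.
    by rewrite -(mulrA M) (mulrC h) ler_wpM2r // mulr_ge0 // ltW.
  have wYV := wup V z2 sV (tV' T eT aT) _ _.
  have wYU := wup U z1 sU (tU' T eT aT) _ _.
  have Yb t : a <= t -> t <= T -> normsq (Y.1 t) <= c * (normsq (U.1 t) + normsq (V.1 t)).
    move=> at_ tT; have et := edge_le (le_trans a0 at_) tT eT.
    have := congr1 (@normsq R) (plucker3 U V Y t); rewrite normsqM => E.
    have := normsqD (U.1 t * wr Y V t) (- (V.1 t * wr Y U t)).
    rewrite -E normsqN !normsqM => E2.
    have {}wYV : normsq (wr Y V t) <= K + M * h * D.
      apply: wYV => //; rewrite /K ?/M; have := normsq_ge0 (wr Y U a).
        by lra.
      by have := normsq_ge0 (z - z1); lra.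
    have {}wYU : normsq (wr Y U t) <= K + M * h * D.
      apply: wYU => //; rewrite /K ?/M; have := normsq_ge0 (wr Y V a).
        by lra.
      by have := normsq_ge0 (z - z2); lra.
    have -> : c * (normsq (U.1 t) + normsq (V.1 t)) =
        (2 * (K + M * h * D) * (normsq (U.1 t) + normsq (V.1 t))) / k by rewrite /c; ring.
    rewrite ler_pdivlMr //.
    apply: (@le_trans _ _ (normsq (Y.1 t) * normsq (wr U V t))).
      by rewrite ler_wpM2l ?normsq_ge0 // wlow.
    apply: le_trans E2 _.
    have j1 := ler_wpM2l (normsq_ge0 (U.1 t)) wYV.
    have j2 := ler_wpM2l (normsq_ge0 (V.1 t)) wYU.
    by move: j1 j2; lra.
  have nU := econt_L1loc (econt_normsq cU); have nV := econt_L1loc (econt_normsq cV).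
  have nUV := L1loc_realD nU nV.
  have := ler_prim eT a0 aT (econt_L1loc (econt_normsq cY)) (L1loc_realZ c nUV) Yb.
  rewrite !(primZ _ _ nUV) // !(primD _ nU nV) // -mulrBr.
  rewrite -/(intsq Y.1 T) -/(intsq Y.1 a) -/D -/(intsq U.1 T) -/(intsq V.1 T) -/(intsq U.1 a) -/(intsq V.1 a).
  move=> i7.
  have i8 : D <= c * (2 * h).
    apply: le_trans i7 _; rewrite ler_wpM2l //.
    by have := tU' T eT aT; have := tV' T eT aT; lra.
  (* The part [D / 2] is absorbed on the left; the resulting bound does not depend on [T]. *)
  have i9 : D <= 4 * K * h / k + D / 2.
    apply: le_trans i8 _.
    have -> : c * (2 * h) = 4 * K * h / k + (8 * M * h ^+ 2) / k * (D / 2).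
      by rewrite /c; field; rewrite gt_eqF.
    rewrite lerD2l ler_piMl ?divr_ge0 //.
    by rewrite ler_pdivrMr // mul1r.
  by move: i9; lra.
exists (intsq Y.1 a + 8 * K * h / k) => t et.
have [at_|ta] := leP a t; first by rewrite addrC -lerBlDr; exact: main.
apply: (@le_trans _ _ (intsq Y.1 a)).
  by apply: (intsq_homo ea) => //; [exact: edge_ge0 et|exact: ltW].
rewrite lerDl divr_ge0 //; last exact: ltW.
by rewrite mulr_ge0 ?mulr_ge0 // ltW.
Qed.

End endpoint.

Definition bc_sol (R : realType) (E : edge_data R) : cpair R :=
  (fun x => (bw E x)%:C, fun x => (dbw E x)%:C).

(* The Weyl solutions of the header, the zero solution included. *)
Definition wsol (R : realType) (E : edge_data R) (z : R[i]) (U : cpair R) : Prop :=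
  [/\ sol (len E) (pot E) z U, L2bounded (len E) U.1 &
      limit_circle (len E) (pot E) -> vanishes (len E) (wr U (bc_sol E))].

(** * Closure properties and Wronskians of Weyl solutions *)

Section weyl_class.
Context {R : realType} (E : edge_data R).
Hypothesis admE : admissible E.
Implicit Types (z : R[i]) (U V Y : cpair R).
Local Notation e := (len E).
Local Notation q := (pot E).

Let e0 : (0%:E < e)%E. Proof. by case: admE. Qed.
Let Lq : L1loc_real e q. Proof. by case: admE. Qed.

Lemma wsolP z (u du : R -> R[i]) :
  wsol E z (u, du) <-> [/\ sl_solution e q z u du, L2 e u & outer_bc E u du].
Proof.
split=> [[s b v]|[s l o]].
  have cu : ccont e u by case: s.
  split; [exact: (sl_of_sol Lq s)|exact/(L2_bounded e0 cu)|].
  by move=> lc; apply/(vanishesP _ e0); exact: v.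
have s' := sol_of_sl Lq s; have cu : ccont e u by case: s'.
split=> //; first exact/(L2_bounded e0 cu).
by move=> lc; apply/(vanishesP _ e0); exact: o.
Qed.

Lemma vanishes_le (f : R -> R[i]) (g : R -> R[i]) (B : R) :
  vanishes e f -> 0 <= B -> (forall t, edge e t -> normsq (g t) <= B * normsq (f t)) -> vanishes e g.
Proof.
move=> vf B0 gf d d0; have [|a ea Ha] := vf (d / (B + 1)).
  by rewrite divr_gt0 //; lra.
exists a => // t et at_; apply: le_lt_trans (gf t et) _.
have := Ha t et at_; rewrite ltr_pdivlMr; last by lra.
by have := normsq_ge0 (f t); lra.
Qed.

Lemma vanishesD (f g : R -> R[i]) : vanishes e f -> vanishes e g ->
  vanishes e (fun t => f t + g t).
Proof.
move=> vf vg d d0; have d4 : 0 < d / 4 by rewrite divr_gt0.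
have [a ea Ha] := vf _ d4; have [b eb Hb] := vg _ d4.
exists (Num.max a b); first exact: edge_max.
move=> t et; rewrite ge_max => /andP[at_ bt].
apply: le_lt_trans (normsqD _ _) _; have := Ha t et at_; have := Hb t et bt; lra.
Qed.

Lemma wsolZ z (c : R[i]) U : wsol E z U -> wsol E z (fun x => c * U.1 x, fun x => c * U.2 x).
Proof.
move=> [s [C HC] v]; split; first exact: solZ.
  exists (normsq c * C) => t et.
  have cU : ccont e U.1 by case: s.
  rewrite (_ : intsq _ t = normsq c * intsq U.1 t); first by rewrite ler_wpM2l ?normsq_ge0 // HC.
  rewrite /intsq -(primZ _ et (econt_L1loc (econt_normsq cU))).
  by apply: eq_prim => x _ _; rewrite normsqM.
move=> lc; apply: (vanishes_le (v lc) (normsq_ge0 c)) => t et.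
rewrite (_ : wr _ _ t = c * wr U (bc_sol E) t) ?normsqM //.
by rewrite /wr /=; ring.
Qed.

Lemma wsolJ z U : wsol E z U ->
  wsol E (conjc z) (fun x => conjc (U.1 x), fun x => conjc (U.2 x)).
Proof.
move=> [s [C HC] v]; split; first exact: solJ.
  exists C => t et; apply: le_trans (HC t et); rewrite le_eqVlt; apply/orP; left; apply/eqP.
  by apply: eq_prim => x _ _; rewrite /= normsqJ.
move=> lc; apply: (vanishes_le (v lc) ler01) => t et.
rewrite (_ : wr _ _ t = conjc (wr U (bc_sol E) t)) ?normsqJ ?mul1r //.
by rewrite /wr /= conjcB !conjcM !conjc_real.
Qed.

Lemma wronskian_bounded z1 z2 U V : sol e q z1 U -> sol e q z2 V ->
  L2bounded e U.1 -> L2bounded e V.1 ->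
  exists2 B : R, 0 <= B & forall t, edge e t -> normsq (wr U V t) <= B.
Proof.
move=> sU sV [C HC] [D HD].
have ez := edge0 e0.
have C0 : 0 <= C by apply: le_trans (HC 0 ez); exact: intsq_ge0.
have D0 : 0 <= D by apply: le_trans (HD 0 ez); exact: intsq_ge0.
have cU : ccont e U.1 by case: sU.
have cV : ccont e V.1 by case: sV.
exists (2 * normsq (wr U V 0) + 2 * (normsq (z1 - z2) * (C * D))).
  by rewrite addr_ge0 // mulr_ge0 ?normsq_ge0 // mulr_ge0 ?normsq_ge0 // mulr_ge0.
move=> t et; apply: le_trans (normsq_le_dist _ (wr U V 0)) _.
rewrite lerD2l ler_pM2l //.
have t0 := edge_ge0 et.
apply: le_trans (wronskian_increment Lq sU sV et (lexx 0) t0) _.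
rewrite ler_wpM2l ?normsq_ge0 //.
have N0 (f : R -> R[i]) : intsq f 0 = 0 by rewrite /intsq prim0.
by rewrite !N0 !subr0; apply: ler_pM; rewrite ?intsq_ge0 ?HC ?HD.
Qed.

Lemma wsol_wronskian_vanishes z1 z2 U V : wsol E z1 U -> wsol E z2 V ->
  vanishes e (wr U V).
Proof.
move=> [sU bU vU] [sV bV vV].
have [lc|nlc] := pselect (limit_circle e q); last first.
  apply: contrapT => nv; apply: nlc => z u du su.
  have sY := sol_of_sl Lq su.
  have cu : ccont e u by case: sY.
  by apply/(L2_bounded e0 cu); exact: (L2bounded_of_wronskian e0 Lq sU sV bU bV nv sY).
have [_ _ /(_ lc)[l0 [sW [x0 ex0 nz]]]] := admE.
have {sW} sW : sol e q l0%:C (bc_sol E) := sol_of_sl Lq sW.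
(* The data of w at 0 are rotated by a right angle, so the constant W(w, S) is w(0)^2 + w'(0)^2,
   nonzero because w is nontrivial. In the Pluecker relation for U, V, w, S each product then has
   one factor that vanishes by the boundary condition and one that is bounded. *)
have [S [sS S1 S2]] := real_sol_exists Lq l0 (- dbw E 0) (bw E 0).
have cS : ccont e S.1 by case: sS.
have bS : L2bounded e S.1.
  by apply/(L2_bounded e0 cS); apply: (lc _ _ _ (sl_of_sol Lq sS)).
set W := bc_sol E in sW vU vV *.
pose k := wr W S 0.
have kE : k = (bw E 0 ^+ 2 + dbw E 0 ^+ 2)%:C.
  rewrite /k /wr /= S1 S2; apply: complex_ext; rewrite !ReImE /=; ring.
have k0 : 0 < normsq k.
  rewrite normsq_gt0; apply/negP => /eqP k0; move: kE; rewrite k0 => -[/esym/eqP].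
  rewrite paddr_eq0 ?sqr_ge0 // !sqrf_eq0 => /andP[/eqP b0 /eqP db0].
  move/eqP: nz; apply.
  have := sol_unique Lq sW (solZ Lq 0 sW).
  rewrite /= b0 db0 mul0r => /(_ erefl erefl x0 ex0) ->.
  by rewrite mul0r.
have [B B0 HB] := wronskian_bounded sV sS bV bS.
have [C C0 HC] := wronskian_bounded sU sS bU bS.
have v1 : vanishes e (fun t => wr U W t * wr V S t).
  by apply: (vanishes_le (vU lc) B0) => t et; rewrite normsqM mulrC ler_wpM2r ?normsq_ge0 ?HB.
have v2 : vanishes e (fun t => - (wr U S t * wr V W t)).
  by apply: (vanishes_le (vV lc) C0) => t et; rewrite normsqN normsqM ler_wpM2r ?normsq_ge0 ?HC.
apply: (@vanishes_le _ _ (normsq k)^-1 (vanishesD v1 v2)).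
  by rewrite invr_ge0 normsq_ge0.
move=> t et; rewrite -(plucker4 U V W S) normsqM (wronskian_const Lq sW sS et) -/k.
by rewrite mulrCA mulVf ?mulr1 // gt_eqF.
Qed.

Lemma vanishes_const (c : R[i]) : vanishes e (fun=> c) -> c = 0.
Proof.
move=> vc; apply/eqP/negPn/negP; rewrite -normsq_gt0 => c0.
by have [a ea /(_ a ea (lexx a))] := vc _ c0; rewrite ltxx.
Qed.

(** At a common parameter the Wronskian is constant and tends to zero at the endpoint, so any two
    Weyl solutions have proportional data at 0. *)
Lemma wsol_wronskian0 z U V : wsol E z U -> wsol E z V -> wr U V 0 = 0.
Proof.
move=> wU wV; apply: vanishes_const => d d0.
have [a ea Ha] := wsol_wronskian_vanishes wU wV d0.
exists a => // t et at_; have := Ha t et at_.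
by case: wU wV => sU _ _ [sV _ _]; rewrite (wronskian_const Lq sU sV et).
Qed.

(** At a real parameter the conjugate is again a Weyl solution, with data proportional to the
    original ones. *)
Lemma wsol_real (x : R) U : wsol E x%:C U -> U.1 0 = 1 -> complex.Im (U.2 0) = 0.
Proof.
move=> wU U1; have wJ := wsolJ wU; rewrite conjc_real in wJ.
have := wsol_wronskian0 wU wJ; rewrite /wr /= U1 conjc1 mul1r mulr1.
by move=> /(congr1 (@complex.Im R)); rewrite !ReImE /= => h; lra.
Qed.

End weyl_class.

(** * The Weyl function near a real point *)

Section weyl_asymptotics.
Context {R : realType} (E : edge_data R).
Hypothesis admE : admissible E.
Implicit Types (z : R[i]) (U V Y P S : cpair R).
Local Notation e := (len E).
Local Notation q := (pot E).
Local Notation Re := complex.Re.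
Local Notation Im := complex.Im.

Let e0 : (0%:E < e)%E. Proof. by case: admE. Qed.
Let Lq : L1loc_real e q. Proof. by case: admE. Qed.

Lemma normsqD4 (a b c d : R[i]) : normsq (a + b + c + d) <= 4 * (normsq a + normsq b + normsq c + normsq d).
Proof.
rewrite -addrA; apply: le_trans (normsqD _ _) _.
by have := normsqD a b; have := normsqD c d; lra.
Qed.

Lemma cprim_normsq (f : R -> R[i]) t : 0 <= t ->
  cprim (fun x => f x * conjc (f x)) t = (intsq f t)%:C.
Proof.
move=> t0; apply: complex_ext => /=; first by apply: eq_prim => x _ _; rewrite mul_conj_normsq.
rewrite (@eq_prim _ _ (fun=> 0)) ?prim_cst ?mul0r // => x _ _.
by rewrite mul_conj_normsq.
Qed.

(** Lagrange's identity for [P] and its conjugate. Since [intsq P.1] is nondecreasing, an excess at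
    one [t] would persist up to the endpoint, where the Wronskian vanishes. *)
Lemma energy_le z P : wsol E z P -> 0 < Im z -> forall t, edge e t ->
  Im z * intsq P.1 t <= Im (P.2 0 * conjc (P.1 0)).
Proof.
move=> wP z0 t et; have wJ := wsolJ admE wP; have v := wsol_wronskian_vanishes admE wP wJ.
have sP : sol e q z P by case: wP.
have sJ : sol e q (conjc z) (fun x => conjc (P.1 x), fun x => conjc (P.2 x)) by case: wJ.
have cP : ccont e P.1 by case: sP.
rewrite leNgt; apply/negP => lt.
set c := Im (P.2 0 * _) in lt.
have [|a ea Ha] := v (4 * (Im z * intsq P.1 t - c) ^+ 2).
  by rewrite mulr_gt0 // exprn_gt0 // subr_gt0.
pose s := Num.max a t; have es : edge e s by exact: edge_max.
have := Ha s es; rewrite le_max lexx => /(_ erefl).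
rewrite (lagrange_identity Lq sP sJ es) /= cprim_normsq ?(edge_ge0 es) // => h.
have := le_lt_trans (normsq_Im _) h.
have -> : Im (wr P (fun x => conjc (P.1 x), fun x => conjc (P.2 x)) 0 +
   (z - conjc z) * (intsq P.1 s)%:C) = 2 * (Im z * intsq P.1 s - c).
  by rewrite /wr /c !ReImE /=; ring.
have : Im z * intsq P.1 t <= Im z * intsq P.1 s.
  by rewrite ler_pM2l // (intsq_homo es) ?(edge_ge0 et) // le_max lexx orbT.
rewrite exprMn -(natrX _ 2 2) ltr_pM2l // => h1; rewrite ltNge => /negP; apply.
by rewrite ler_pXn2r ?nnegrE ?subr_ge0 ?lerB //; [exact: ltW|apply: le_trans h1; exact: ltW].
Qed.

(* [psi = u W(psi, s) - s W(psi, u)] compares solutions with neighbouring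
   spectral parameters on compact subintervals. *)
Lemma local_estimate (x : R) z U P S T : sol e q x%:C U -> sol e q x%:C S ->
  sol e q z P -> U.1 0 = 1 -> P.1 0 = 1 -> S.1 0 = 0 -> S.2 0 = 1 -> edge e T ->
  intsq (fun t => P.1 t - U.1 t) T <=
    6 * (normsq (z - x%:C) * intsq P.1 T * intsq U.1 T * intsq S.1 T) + 4 * intsq S.1 T * normsq (P.2 0 - U.2 0).
Proof.
move=> sU sS sP U0 P0 S0 S1 eT.
have cU : ccont e U.1 by case: sU.
have cS : ccont e S.1 by case: sS.
have cP : ccont e P.1 by case: sP.
have N0 (f : R -> R[i]) : intsq f 0 = 0 by rewrite /intsq prim0.
set NP := intsq P.1 T; set NU := intsq U.1 T; set NS := intsq S.1 T.
set D := normsq (P.2 0 - U.2 0); set Z := normsq (z - x%:C).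
have Z0 : 0 <= Z := normsq_ge0 _; have D0 : 0 <= D := normsq_ge0 _.
have NP0 : 0 <= NP := intsq_ge0 _ _; have NU0 : 0 <= NU := intsq_ge0 _ _.
have NS0 : 0 <= NS := intsq_ge0 _ _.
have cs V t : ccont e V.1 -> 0 <= t -> t <= T ->
    normsq (cprim (fun x => P.1 x * V.1 x) t) <= NP * intsq V.1 T.
  move=> cV t0 tT; have et := edge_le t0 tT eT.
  have := cauchy_schwarz et (lexx 0) t0 cP cV; rewrite cprim0 !N0 !subr0 => /le_trans; apply.
  by apply: ler_pM; rewrite ?intsq_ge0 // (intsq_homo eT).
(* Integrating this bound multiplies the first term by [NU] and the second by [NS]; the coefficients
   2 and 4 of [Z * NP * NU * NS] add up to the 6 of the statement. *)
have pt t : 0 <= t -> t <= T -> normsq (P.1 t - U.1 t) <=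
    (2 * Z * NP * NS) * normsq (U.1 t) + (4 * (D + Z * NP * NU)) * normsq (S.1 t).
  move=> t0 tT; have et := edge_le t0 tT eT.
  have wUS : wr U S t = 1.
    by rewrite (wronskian_const Lq sU sS et) /wr U0 S0 S1 mulr1 mulr0 subr0.
  have := plucker3 U S P t; rewrite wUS mulr1.
  rewrite (lagrange_identity Lq sP sS et) (lagrange_identity Lq sP sU et).
  set c1 := cprim _ t; set c2 := cprim _ t => E1.
  have -> : P.1 t - U.1 t = (z - x%:C) * c1 * U.1 t +
      ((P.2 0 - U.2 0) + - ((z - x%:C) * c2)) * S.1 t.
    by rewrite E1 /wr U0 P0 S0 S1; ring.
  have h1 : normsq c1 <= NP * NS by exact: cs.
  have h2 : normsq c2 <= NP * NU by exact: cs.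
  apply: le_trans (normsqD _ _) _; rewrite !normsqM.
  have h3 := normsqD (P.2 0 - U.2 0) (- ((z - x%:C) * c2)); rewrite normsqN normsqM -/D -/Z in h3.
  rewrite -/Z.
  apply: lerD.
    rewrite mulrA ler_wpM2r ?normsq_ge0 // -!mulrA ler_pM2l // ler_wpM2l //.
  rewrite mulrA ler_wpM2r ?normsq_ge0 //.
  have h4 : Z * normsq c2 <= Z * (NP * NU) by rewrite ler_wpM2l.
  by move: h3 h4; lra.
have LU := econt_L1loc (econt_normsq cU); have LS := econt_L1loc (econt_normsq cS).
have LPU := econt_L1loc (econt_normsq (ccontD cP (ccontN cU))).
apply: le_trans (ler_prim0 eT LPU (L1loc_realD (L1loc_realZ _ LU) (L1loc_realZ _ LS)) pt) _.
rewrite (primD eT (L1loc_realZ _ LU) (L1loc_realZ _ LS)) (primZ _ eT LU) (primZ _ eT LS).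
rewrite -/(intsq U.1 T) -/(intsq S.1 T) -/NU -/NS.
by rewrite le_eqVlt; apply/orP; left; apply/eqP; ring.
Qed.

Variable m : R[i] -> R[i].
Hypothesis wm : weyl_function E m.
Variable x : R.

(** The given solution may be divided by its value at 0: were that value zero, [energy_le] would
    make every [intsq] nonpositive, against nontriviality. *)
Lemma weyl_normalised (z : R[i]) : 0 < Im z -> exists P : cpair R,
  [/\ wsol E z P, P.1 0 = 1 & P.2 0 = m z].
Proof.
move=> z0; have [|psi [dpsi [[s nt l b] ->]]] := wm (z := z); first by rewrite gt_eqF.
have wP : wsol E z (psi, dpsi) by apply/wsolP.
have cP : ccont e psi by case: wP => -[].
have p0 : psi 0 != 0.
  apply/negP => /eqP p0; have [y ey] := nt; rewrite -normsq_gt0 => ny.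
  have [t et] := prim_gt0 (econt_normsq cP) (fun x _ => normsq_ge0 (psi x)) ey ny.
  have := energy_le wP z0 et; rewrite /= p0 conjc0 mulr0 /= pmulr_rle0 //.
  by rewrite /intsq leNgt => /negP.
exists (fun x => (psi 0)^-1 * psi x, fun x => (psi 0)^-1 * dpsi x).
by split; [exact: (wsolZ admE _ wP)|rewrite /= mulVf|rewrite /= mulrC].
Qed.

Lemma shiftB (d : R) : (x +i* d) - x%:C = 0 +i* d.
Proof. by apply: complex_ext; rewrite !ReImE /= ?subrr ?subr0. Qed.

Lemma normsq_imag (d : R) : normsq (0 +i* d) = d ^+ 2.
Proof. by rewrite /normsq /= expr0n add0r. Qed.

End weyl_asymptotics.

(** * From a Weyl solution at x to the limits of the Weyl function *)

Section boundary_values.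
Context {R : realType} (E : edge_data R).
Hypothesis admE : admissible E.
Variable m : R[i] -> R[i].
Hypothesis wm : weyl_function E m.
Variable x : R.
Implicit Types (z : R[i]) (U V Y P S : cpair R).
Local Notation e := (len E).
Local Notation q := (pot E).
Local Notation Re := complex.Re.
Local Notation Im := complex.Im.

Let e0 : (0%:E < e)%E. Proof. by case: admE. Qed.
Let Lq : L1loc_real e q. Proof. by case: admE. Qed.

(** A bootstrap on Im P'(0), which bounds [eps * intsq P.1 t] by [energy_le]. Lagrange's identity
    for U and P then gives |P'(0) - U'(0)|^2 <= 2 c eps Im P'(0), and as U'(0) is real the left side
    is at least (Im P'(0))^2. Hence Im P'(0) <= 2 c eps, and both claims follow. *)
Lemma wsol_value_bounds (c eps : R) U P : wsol E x%:C U -> U.1 0 = 1 ->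
  (forall t, edge e t -> intsq U.1 t <= c) -> 0 < eps -> wsol E (x +i* eps) P -> P.1 0 = 1 ->
  (forall t, edge e t -> intsq P.1 t <= 2 * c) /\
  normsq (P.2 0 - U.2 0) <= 4 * c ^+ 2 * eps ^+ 2.
Proof.
move=> wU U0 Uc eps0 wP P0.
have sU : sol e q x%:C U by case: wU.
have sP : sol e q (x +i* eps) P by case: wP.
have cU : ccont e U.1 by case: sU.
have cP : ccont e P.1 by case: sP.
have ez := edge0 e0.
have c0 : 0 <= c by apply: le_trans (Uc 0 ez); exact: intsq_ge0.
have iU := wsol_real admE wU U0.
have en t : edge e t -> eps * intsq P.1 t <= Im (P.2 0).
  by move=> et; have := energy_le admE wP eps0 et; rewrite P0 conjc1 mulr1.
have m0 : 0 <= Im (P.2 0).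
  by apply: le_trans (en 0 ez); rewrite mulr_ge0 ?intsq_ge0 // ltW.
set D := normsq (P.2 0 - U.2 0).
have DB : D <= 2 * c * eps * Im (P.2 0).
  (* W(U, P) vanishes only in the limit; [d] pays for stopping at a point [a] of the edge. *)
  apply/ler_addgt0Pr => d d0.
  have [|a ea Ha] := wsol_wronskian_vanishes admE wU wP (d := d / 2); first by rewrite divr_gt0.
  have := Ha a ea (lexx a); rewrite (lagrange_identity Lq sU sP ea).
  set J := cprim _ a.
  have NJ : normsq J <= c * (Im (P.2 0) / eps).
    have := cauchy_schwarz ea (lexx 0) (edge_ge0 ea) cU cP.
    rewrite cprim0 /intsq !prim0 !subr0 => /le_trans; apply.
    apply: ler_pM; rewrite ?intsq_ge0 //; first exact: Uc.
    by rewrite ler_pdivlMr // mulrC en.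
  have -> : wr U P 0 = P.2 0 - U.2 0 by rewrite /wr U0 P0 mul1r mulr1.
  have -> : x%:C - (x +i* eps) = - (0 +i* eps) by rewrite -(shiftB x) opprB.
  rewrite mulNr => h.
  have := normsqD (P.2 0 - U.2 0 - (0 +i* eps) * J) ((0 +i* eps) * J).
  rewrite subrK -/D normsqM normsq_imag => h2.
  have h3 : eps ^+ 2 * normsq J <= c * eps * Im (P.2 0).
    apply: (@le_trans _ _ (eps ^+ 2 * (c * (Im (P.2 0) / eps)))).
      by rewrite ler_pM2l // exprn_gt0.
    rewrite le_eqVlt; apply/orP; left; apply/eqP; field; by rewrite gt_eqF.
  by move: h h2 h3; lra.
have ImB : Im (P.2 0) <= 2 * c * eps.
  have : Im (P.2 0) ^+ 2 <= 2 * c * eps * Im (P.2 0).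
    by apply: le_trans DB; have := normsq_Im (P.2 0 - U.2 0); rewrite ReImE ReImE iU subr0.
  move: m0; rewrite le_eqVlt => /predU1P[<- _|m0].
    by rewrite mulr_ge0 ?mulr_ge0 // ltW.
  by rewrite expr2 ler_pM2r.
split=> [t et|].
  have := le_trans (en t et) ImB.
  by rewrite mulrC ler_pM2r.
apply: le_trans DB _.
have -> : 4 * c ^+ 2 * eps ^+ 2 = 2 * c * eps * (2 * c * eps) by ring.
by rewrite ler_wpM2l // mulr_ge0 ?mulr_ge0 // ltW.
Qed.

Lemma weyl_limit U : wsol E x%:C U -> U.1 0 = 1 ->
  ((m (x +i* eps) : Cplx R) @[eps --> 0^'+] --> (((Re (U.2 0))%:C) : Cplx R)) /\
  exists2 c : R, 0 <= c &
    ((m (x +i* eps) - (Re (U.2 0))%:C) / (0 +i* eps) : Cplx R)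
      @[eps --> 0^'+] --> (c%:C : Cplx R).
Proof.
move=> wU U0.
have sU : sol e q x%:C U by case: wU.
have cU : ccont e U.1 by case: sU.
have bU : L2bounded e U.1 by case: wU.
have ez := edge0 e0.
have iU := wsol_real admE wU U0.
have mxE : (Re (U.2 0))%:C = U.2 0 by apply: complex_ext.
rewrite mxE.
pose A := [set intsq U.1 t | t in edge e].
have hA : has_sup A.
  by case: bU => C HC; split; [exists (intsq U.1 0); exists 0|exists C => _ [t et <-]; exact: HC].
pose c := sup A.
have Uc t : edge e t -> intsq U.1 t <= c by move=> et; apply: sup_upper_bound => //; exists t.
have c0 : 0 <= c by apply: le_trans (Uc 0 ez); exact: intsq_ge0.
have bounds eps : 0 < eps -> exists P, [/\ wsol E (x +i* eps) P, P.1 0 = 1, P.2 0 = m (x +i* eps),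
    forall t, edge e t -> intsq P.1 t <= 2 * c & normsq (P.2 0 - U.2 0) <= 4 * c ^+ 2 * eps ^+ 2].
  move=> eps0; have [P [wP P0 P1]] := weyl_normalised admE wm (z := x +i* eps) eps0.
  by exists P; have [b1 b2] := wsol_value_bounds wU U0 Uc eps0 wP P0; split.
have small (K d : R) : 0 <= K -> 0 < d ->
    exists2 r : R, 0 < r & forall eps, 0 < eps -> eps < r -> K * eps ^+ 2 < d.
  move=> K0 d0; exists (Num.min 1 (d / (K + 1))).
    by rewrite lt_min ltr01 divr_gt0 //; lra.
  move=> eps eps0; rewrite lt_min => /andP[e1 e2].
  have K1 : 0 < K + 1 by lra.
  have h1 : eps ^+ 2 <= eps by rewrite expr2 ler_piMl // ltW.
  have h2 : eps * (K + 1) < d by rewrite -ltr_pdivlMr.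
  have h3 : K * eps ^+ 2 <= K * eps by rewrite ler_wpM2l.
  by lra.
split.
  apply/cvg_normsqP => d d0; apply/at_rightP.
  have [|r r0 Hr] := small (4 * c ^+ 2) d _ d0; first by rewrite mulr_ge0 // sqr_ge0.
  exists r => // eps eps0 epsr; have [P [_ _ <- _ b]] := bounds eps eps0.
  exact: le_lt_trans b (Hr _ eps0 epsr).
exists c => //; apply/cvg_normsqP => d d0; apply/at_rightP.
have [S [sS S0 S1]] := real_sol_exists Lq x 0 1.
(* The difference is split into four terms of squared modulus at most [k]; [normsqD4] bounds the
   total by [16 * k = d / 2]. *)
pose k := d / 32.
have k0 : 0 < k by rewrite divr_gt0.
(* [6 * c] bounds the squared norm of [F] below; [h] makes both the missing part of the norm of [U]
   and its product with [6 * c] at most [k]. *)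
pose h := Num.min 1 (k / (6 * c + 1)).
have c6 : 0 < 6 * c + 1 by lra.
have h0 : 0 < h by rewrite lt_min ltr01 divr_gt0.
have h1 : h <= 1 by rewrite ge_min lexx.
have hk : h * (6 * c + 1) <= k by rewrite -ler_pdivlMr // ge_min lexx orbT.
have hk' : h <= k by have : 0 <= h * (6 * c) by [rewrite mulr_ge0 ?mulr_ge0 // ltW]; lra.
have [_ [a ea <-] Ha] := sup_adherent h0 hA.
have a0 := edge_ge0 ea.
set NS := intsq S.1 a; have NS0 : 0 <= NS := intsq_ge0 _ _.
(* The coefficient of [eps ^+ 2] when [local_estimate] on [[0, a]], with the bounds on P inserted,
   is multiplied by [c]. *)
pose K := c * (6 * (2 * c * c * NS) + 4 * NS * (4 * c ^+ 2)).
have K0 : 0 <= K.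
  by rewrite mulr_ge0 // addr_ge0 // ?mulr_ge0 // ?mulr_ge0 // sqr_ge0.
have [r r0 Hr] := small K k K0 k0.
exists r => // eps eps0 epsr; have [P [wP P0 P1 Pc PD]] := bounds eps eps0.
rewrite -P1.
have sP : sol e q (x +i* eps) P by case: wP.
have cP : ccont e P.1 by case: sP.
pose V : cpair R := (fun x => conjc (U.1 x), fun x => conjc (U.2 x)).
have wV : wsol E x%:C V by have := wsolJ admE wU; rewrite conjc_real.
have sV : sol e q x%:C V by case: wV.
have cV : ccont e V.1 by case: sV.
have NV t : intsq V.1 t = intsq U.1 t by apply: eq_prim => y _ _; rewrite /= normsqJ.
have V0 : V.1 0 = 1 by rewrite /= U0 conjc1.
have V1 : V.2 0 = U.2 0 by rewrite /= -mxE conjc_real.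
pose F t := P.1 t - U.1 t.
have cF : ccont e F by apply: ccontD cP (ccontN cU).
have NF t : edge e t -> intsq F t <= 6 * c.
  move=> et; apply: le_trans (intsqD et cP (ccontN cU)) _.
  have -> : intsq (fun y => - U.1 y) t = intsq U.1 t by apply: eq_prim => y _ _; rewrite normsqN.
  by have := Pc t et; have := Uc t et; lra.
have e2 : 0 < eps ^+ 2 by rewrite exprn_gt0.
have [|b eb Hb] := wsol_wronskian_vanishes admE wV wP (d := k * eps ^+ 2).
  by rewrite mulr_gt0.
(* [a] was fixed before [eps], whereas [t] may depend on [eps]: it lies so far out that W(V, P)
   stays small after division by i eps. *)
pose t := Num.max a b; have et : edge e t by exact: edge_max.
have t0 := edge_ge0 et.
have at_ : a <= t by rewrite le_max lexx.
have := Hb t et; rewrite le_max lexx orbT => /(_ erefl) Hw.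
have wE := lagrange_identity Lq sV sP et.
have wE0 : wr V P 0 = P.2 0 - U.2 0 by rewrite /wr V0 V1 P0 mul1r mulr1.
pose w : R[i] := 0 +i* eps.
have w0 : w != 0 by rewrite -normsq_gt0 normsq_imag.
have zx : x%:C - (x +i* eps) = - w by rewrite /w -(shiftB x) opprB.
rewrite wE0 zx mulNr in wE.
have LVU := ccont_L1loc (ccontM cV cU).
have LVF := ccont_L1loc (ccontM cV cF).
have splitJ : cprim (fun y => V.1 y * P.1 y) t = (intsq U.1 t)%:C + cprim (fun y => V.1 y * F y) t.
  rewrite -cprim_normsq // -(cprimD et _ LVF).
    by apply: eq_cprim => y _ _; rewrite /F /=; ring.
  by apply: eq_L1loc LVU => y _; rewrite mulrC.
(* The four terms are the Wronskian at [t], the missing tail of the norm of [U], and the integral of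
   [V * F] over [[0, a]] and over [[a, t]]. *)
have -> : (P.2 0 - U.2 0) / w - c%:C = wr V P t / w + ((intsq U.1 t)%:C - c%:C) +
    cprim (fun y => V.1 y * F y) a +
    (cprim (fun y => V.1 y * F y) t - cprim (fun y => V.1 y * F y) a).
  by rewrite wE splitJ; field.
apply: le_lt_trans (normsqD4 _ _ _ _) _.
have j1 : normsq (wr V P t / w) <= k.
  have : normsq (wr V P t / w) * normsq w < k * eps ^+ 2 by rewrite -normsqM divfK.
  by rewrite normsq_imag ltr_pM2r // => /ltW.
have j2 : normsq ((intsq U.1 t)%:C - c%:C) <= k.
  rewrite -rmorphB normsqR; apply: le_trans hk'.
  have i1 : intsq U.1 a <= intsq U.1 t by exact: (intsq_homo et).
  have i2 := Uc t et.
  have i3 : c - intsq U.1 t <= h by move: Ha; rewrite -/c; lra.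
  rewrite -sqrrN opprB expr2; apply: (@le_trans _ _ (h * 1)); last by rewrite mulr1.
  by apply: ler_pM; rewrite ?subr_ge0 //; apply: le_trans i3 h1.
have j3 : normsq (cprim (fun y => V.1 y * F y) a) <= k.
  have := cauchy_schwarz ea (lexx 0) a0 cV cF.
  rewrite cprim0 [intsq _ 0]prim0 [intsq F 0]prim0 !subr0 NV => /le_trans; apply.
  have le := local_estimate admE sU sS sP U0 P0 S0 S1 ea.
  rewrite shiftB normsq_imag -/NS -/F in le.
  apply: le_trans (ltW (Hr eps eps0 epsr)).
  rewrite /K -(mulrA c); apply: ler_pM; rewrite ?intsq_ge0 //; first exact: Uc.
  apply: le_trans le _.
  have i1 : intsq P.1 a * intsq U.1 a <= 2 * c * c by apply: ler_pM; rewrite ?intsq_ge0 ?Pc ?Uc.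
  have i2 : eps ^+ 2 * NS * (intsq P.1 a * intsq U.1 a) <= eps ^+ 2 * NS * (2 * c * c).
    by rewrite ler_wpM2l // mulr_ge0 // ltW.
  have i3 : NS * normsq (P.2 0 - U.2 0) <= NS * (4 * c ^+ 2 * eps ^+ 2) by rewrite ler_wpM2l.
  by move: i2 i3; lra.
have j4 : normsq (cprim (fun y => V.1 y * F y) t - cprim (fun y => V.1 y * F y) a) <= k.
  apply: le_trans (cauchy_schwarz et a0 at_ cV cF) _.
  rewrite !NV; apply: le_trans hk.
  have i1 := Uc t et; have i2 := NF t et; have i3 := intsq_ge0 F a.
  have i4 : 0 <= intsq U.1 t - intsq U.1 a by rewrite subr_ge0 (intsq_homo et).
  have i5 : 0 <= intsq F t - intsq F a by rewrite subr_ge0 (intsq_homo et).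
  by apply: ler_pM => //; [move: Ha; rewrite -/c; lra|lra].
by move: j1 j2 j3 j4; rewrite /k; lra.
Qed.

End boundary_values.

(** * From the limits of the Weyl function to a Weyl solution at x *)

Section converse.
Context {R : realType} (E : edge_data R).
Hypothesis admE : admissible E.
Variable m : R[i] -> R[i].
Hypothesis wm : weyl_function E m.
Variable x : R.
Implicit Types (z : R[i]) (U V Y P S : cpair R).
Local Notation e := (len E).
Local Notation q := (pot E).
Local Notation Re := complex.Re.
Local Notation Im := complex.Im.

Let e0 : (0%:E < e)%E. Proof. by case: admE. Qed.
Let Lq : L1loc_real e q. Proof. by case: admE. Qed.

Lemma divc_imag (w : R[i]) (d : R) : Re (w / (0 +i* d)) = Im w / d.
Proof.
case: w => a b; rewrite ReM /=.
have [->|d0] := eqVneq d 0; first by rewrite !invr0 expr0n /= addr0 invr0; ring.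
by field.
Qed.

(** The real part of the difference quotient is Im m / eps, which dominates [intsq P.1] by
    [energy_le]. Its convergence thus bounds the normalised solutions P uniformly, by [c + 1] once
    the quotient is within 1 of [c]. *)
Lemma wsol_of_weyl_limit (mx c : R) : 0 <= c ->
  ((m (x +i* eps) : Cplx R) @[eps --> 0^'+] --> (mx%:C : Cplx R)) ->
  (((m (x +i* eps) - mx%:C) / (0 +i* eps) : Cplx R)
      @[eps --> 0^'+] --> (c%:C : Cplx R)) ->
  exists U : cpair R, [/\ wsol E x%:C U, U.1 0 = 1 & U.2 0 = mx%:C].
Proof.
move=> c0 cv1 cv2.
have [U [sU U0 U1]] := real_sol_exists Lq x 1 mx.
have [S [sS S0 S1]] := real_sol_exists Lq x 0 1.
have cU : ccont e U.1 by case: sU.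
pose p := c + 1.
have p0 : 0 < p by rewrite /p; lra.
(* On any [[0, T]], [U] is approximated by normalised Weyl solutions at nonreal points whose norms
   are bounded by [p], whatever [T] and [d] are. *)
have approx (T d : R) : edge e T -> 0 < d -> exists eps P,
    [/\ [/\ 0 < eps, eps ^+ 2 < d & eps < 1], wsol E (x +i* eps) P /\ P.1 0 = 1,
     forall t, edge e t -> intsq P.1 t <= p, normsq (P.2 0 - mx%:C) < d &
     intsq (fun t => P.1 t - U.1 t) T < d].
  move=> eT d0.
  pose K := 6 * (p * intsq U.1 T * intsq S.1 T) + 4 * intsq S.1 T.
  have K0 : 0 <= K.
    have pU : 0 <= p * intsq U.1 T by rewrite mulr_ge0 ?intsq_ge0 // ltW.
    by rewrite addr_ge0 // mulr_ge0 ?intsq_ge0 // mulr_ge0 ?intsq_ge0.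
  pose d' := Num.min d (d / (K + 1)).
  have K1 : 0 < K + 1 by lra.
  have d'0 : 0 < d' by rewrite lt_min d0 divr_gt0.
  have dd' : d' <= d by rewrite ge_min lexx.
  have Kd' : K * d' < d.
    have : (K + 1) * d' <= d by rewrite mulrC -ler_pdivlMr // ge_min lexx orbT.
    by lra.
  clearbody d'.
  have /cvg_normsqP/(_ _ d'0)/at_rightP[r1 r10 H1] := cv1.
  have /cvg_normsqP/(_ 1 ltr01)/at_rightP[r2 r20 H2] := cv2.
  pose eps := Num.min (Num.min r1 r2) (Num.min 1 d') / 2.
  have m0 : 0 < Num.min (Num.min r1 r2) (Num.min 1 d') by rewrite !lt_min r10 r20 ltr01 d'0.
  have eps0 : 0 < eps by rewrite divr_gt0.
  have epsm : eps < Num.min (Num.min r1 r2) (Num.min 1 d') by rewrite /eps ltr_pdivrMr // ltr_pMr // ltr1n.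
  move: epsm; rewrite !lt_min => /andP[/andP[er1 er2] /andP[e1 ed]].
  have e2 : eps ^+ 2 < d'.
    by apply: le_lt_trans ed; rewrite expr2 ler_piMl // ltW.
  have [P [wP P0 P1]] := weyl_normalised admE wm (z := x +i* eps) eps0.
  have h1 := H1 eps eps0 er1; have h2 := H2 eps eps0 er2.
  rewrite -P1 in h1 h2.
  have sP : sol e q (x +i* eps) P by case: wP.
  have Pp t : edge e t -> intsq P.1 t <= p.
    move=> et; have := energy_le admE wP eps0 et; rewrite P0 conjc1 mulr1 => h3.
    have := le_lt_trans (normsq_Re _) h2; rewrite ReD ReN divc_imag ReImE /= => h4.
    have : Im (P.2 0) / eps - c < 1.
      rewrite ltNge; apply/negP => h5; move: h4; rewrite ltNge => /negP; apply.
      rewrite oppr0 addr0 expr2; apply: (@le_trans _ _ (1 * 1)); first by rewrite mulr1.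
      exact: ler_pM.
    have : intsq P.1 t <= Im (P.2 0) / eps by rewrite ler_pdivlMr // mulrC.
    by rewrite /p; lra.
  exists eps, P; split => //.
  - by split=> //; exact: lt_le_trans e2 dd'.
  - exact: lt_le_trans h1 dd'.
  - have := local_estimate admE sU sS sP U0 P0 S0 S1 eT; rewrite shiftB normsq_imag U1.
    move=> /le_lt_trans; apply; apply: le_lt_trans Kd'.
    have NS0 := intsq_ge0 S.1 T; have NU0 := intsq_ge0 U.1 T; have NP0 := intsq_ge0 P.1 T.
    have i1 : eps ^+ 2 * intsq P.1 T <= d' * p.
      by apply: ler_pM => //; [exact: sqr_ge0|exact: ltW|exact: Pp].
    have i2 : eps ^+ 2 * intsq P.1 T * (intsq U.1 T * intsq S.1 T) <= d' * p * (intsq U.1 T * intsq S.1 T).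
      by rewrite ler_wpM2r // mulr_ge0.
    have i3 : intsq S.1 T * normsq (P.2 0 - mx%:C) <= intsq S.1 T * d' by rewrite ler_wpM2l // ltW.
    by rewrite /K; move: i2 i3; lra.
have bU : L2bounded e U.1.
  (* [U] is [P] minus the difference [P - U], whose squared norm on [[0, T]] is below 1. *)
  exists (2 * p + 2) => T eT.
  have [eps [P [[eps0 _ _] [wP P0] Pp _ PU]]] := approx T 1 eT ltr01.
  have cP : ccont e P.1 by case: wP => -[].
  have := intsqD eT cP (ccontN (ccontD cP (ccontN cU))).
  have -> : intsq (fun y => P.1 y + - (P.1 y + - U.1 y)) T = intsq U.1 T.
    by apply: eq_prim => y _ _; congr normsq; ring.
  have -> : intsq (fun y => - (P.1 y + - U.1 y)) T = intsq (fun y => P.1 y - U.1 y) T.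
    by apply: eq_prim => y _ _; rewrite normsqN.
  by have := Pp T eT; lra.
exists U; split => //; split => // lc.
have [_ _ /(_ lc)[l0 [sW _]]] := admE.
have {sW} sW : sol e q l0%:C (bc_sol E) := sol_of_sl Lq sW.
have lW : L2 e (bc_sol E).1 by apply: (lc _ _ _ (sl_of_sol Lq sW)).
set W := bc_sol E in sW lW *.
have cW : ccont e W.1 by case: sW.
have bW : L2bounded e W.1 by apply/(L2_bounded e0 cW).
move=> d d0.
pose L := (x - l0) ^+ 2 + 1.
have L0 : 0 < L by rewrite /L; have := sqr_ge0 (x - l0); lra.
(* [L] bounds |x + i eps - l0|^2 for [eps < 1], so that [L * (p * h) = d / 8] bounds the increments
   of W(P, w) beyond [a], uniformly in [eps]. *)
pose h := d / (8 * (L * p)).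
have Lp : 0 < 8 * (L * p) by rewrite mulr_gt0 // mulr_gt0.
have h0 : 0 < h by rewrite divr_gt0.
have [a ea Ha] := tail_small e0 cW bW h0.
exists a => // t et at_.
have t0 := edge_ge0 et.
set NW := intsq W.1 t; have NW0 : 0 <= NW := intsq_ge0 _ _.
pose K := 8 * (normsq (W.1 0) + (x - l0) ^+ 2 * NW + p * NW).
have K0 : 0 <= K.
  have := normsq_ge0 (W.1 0) => i1.
  have i2 : 0 <= (x - l0) ^+ 2 * NW by rewrite mulr_ge0 // sqr_ge0.
  have i3 : 0 <= p * NW by rewrite mulr_ge0 // ltW.
  by rewrite /K; lra.
have K1 : 0 < K + 1 by lra.
pose d' := d / 8 / (K + 1).
have d'0 : 0 < d' by rewrite !divr_gt0.
have Kd : K * d' <= d / 8.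
  have : (K + 1) * d' = d / 8 by rewrite /d'; field; rewrite gt_eqF.
  by lra.
(* [t] is fixed before [eps], so [d'] may depend on [t] through the norm [NW] of w on [[0, t]]. *)
have [eps [P [[eps0 ed e1] [wP P0] Pp PU1 PU]]] := approx t d' et d'0.
have sP : sol e q (x +i* eps) P by case: wP.
have cP : ccont e P.1 by case: sP.
have bP : L2bounded e P.1 by case: wP.
(* W(P, w) at t is small, uniformly in eps *)
have j1 : normsq (wr P W t) <= d / 4.
  have [_ _ /(_ lc) vP] := wP.
  apply/ler_addgt0Pr => r r0.
  have [|b eb Hb] := vP (r / 2); first by rewrite divr_gt0.
  pose s := Num.max t b; have es : edge e s by exact: edge_max.
  have ts : t <= s by rewrite le_max lexx.
  have := Hb s es; rewrite le_max lexx orbT => /(_ erefl) k1.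
  have k2 := normsq_le_dist (wr P W t) (wr P W s).
  have k3 := wronskian_increment Lq sP sW es t0 ts.
  have k4 : normsq (x +i* eps - l0%:C) <= L.
    rewrite /normsq !ReImE /= subr0 lerD2l.
    by rewrite -[leRHS](expr1n _ 2) ler_pXn2r ?nnegrE // ltW.
  have k5 : intsq W.1 s - intsq W.1 t <= h by apply/ltW/Ha.
  have k6 : intsq P.1 s - intsq P.1 t <= p by have := Pp s es; have := intsq_ge0 P.1 t; lra.
  have k7 : 0 <= intsq W.1 s - intsq W.1 t by rewrite subr_ge0 (intsq_homo es).
  have k8 : 0 <= intsq P.1 s - intsq P.1 t by rewrite subr_ge0 (intsq_homo es).
  have k9 : normsq (wr P W s - wr P W t) <= L * (p * h).
    apply: le_trans k3 _; apply: ler_pM; rewrite ?normsq_ge0 //; first exact: mulr_ge0.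
    exact: ler_pM.
  have k10 : L * (p * h) = d / 8 by rewrite /h; field; rewrite !gt_eqF.
  have k11 : normsq (wr P W t - wr P W s) = normsq (wr P W s - wr P W t) by rewrite -normsqN opprB.
  by move: k1 k2 k9; rewrite k10 k11; lra.
have LUW := ccont_L1loc (ccontM cU cW); have LPW := ccont_L1loc (ccontM cP cW).
have j2 : normsq (wr U W t - wr P W t) <= d / 8.
  have cD := ccontD cP (ccontN cU).
  (* The errors come from the data at 0, from [P - U] on [[0, t]] and from the shift of the
     parameter; the final 0 fits the sum to [normsqD4]. *)
  have E1 : wr U W t - wr P W t = (P.2 0 - mx%:C) * W.1 0 +
      - ((x - l0)%:C * cprim (fun y => (P.1 y + - U.1 y) * W.1 y) t) +
      - ((0 +i* eps) * cprim (fun y => P.1 y * W.1 y) t) + 0.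
    have -> : cprim (fun y => (P.1 y + - U.1 y) * W.1 y) t =
        cprim (fun y => P.1 y * W.1 y) t - cprim (fun y => U.1 y * W.1 y) t.
      by rewrite -(cprimB et LPW LUW); apply: eq_cprim => y _ _; ring.
    rewrite (lagrange_identity Lq sU sW et) (lagrange_identity Lq sP sW et) /wr U0 U1 P0.
    by rewrite -(shiftB x) rmorphB /=; ring.
  rewrite E1; apply: le_trans (normsqD4 _ _ _ _) _.
  rewrite normsq0 !normsqN !normsqM normsqR normsq_imag.
  have N0 (f : R -> R[i]) : intsq f 0 = 0 by rewrite /intsq prim0.
  have i1 := cauchy_schwarz et (lexx 0) t0 cD cW.
  have i2 := cauchy_schwarz et (lexx 0) t0 cP cW.
  rewrite !cprim0 !N0 !subr0 -/NW in i1 i2.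
  have i3 : normsq (P.2 0 - mx%:C) * normsq (W.1 0) <= d' * normsq (W.1 0).
    by rewrite ler_wpM2r ?normsq_ge0 // ltW.
  have i4 : (x - l0) ^+ 2 * normsq (cprim (fun y => (P.1 y + - U.1 y) * W.1 y) t) <=
      (x - l0) ^+ 2 * (d' * NW).
    rewrite ler_wpM2l ?sqr_ge0 //; apply: le_trans i1 _.
    by rewrite ler_wpM2r // ltW.
  have i5 : eps ^+ 2 * normsq (cprim (fun y => P.1 y * W.1 y) t) <= d' * (p * NW).
    apply: ler_pM; rewrite ?normsq_ge0 ?sqr_ge0 //; first exact: ltW.
    by apply: le_trans i2 _; rewrite ler_wpM2r // Pp.
  apply: le_trans Kd; rewrite /K; move: i3 i4 i5.
  have i6 : 0 <= d' * normsq (W.1 0) by rewrite mulr_ge0 ?normsq_ge0 // ltW.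
  have i7 : 0 <= (x - l0) ^+ 2 * (d' * NW) by rewrite mulr_ge0 ?sqr_ge0 // mulr_ge0 // ltW.
  have i8 : 0 <= d' * (p * NW) by exact: mulr_ge0 (ltW d'0) (mulr_ge0 (ltW p0) NW0).
  by lra.
have := normsq_le_dist (wr U W t) (wr P W t).
by move: j1 j2; lra.
Qed.

End converse.

(** * The star-graph *)

Lemma admissible_L1 (R : realType) (E : edge_data R) :
  admissible E -> L1loc_real (len E) (pot E).
Proof. by case. Qed.

Section edge_spectrum.
Context {R : realType} (E : edge_data R).
Hypothesis admE : admissible E.
Variable x : R.
Implicit Types (z : R[i]) (U V Y P S : cpair R).
Local Notation e := (len E).
Local Notation q := (pot E).

Let e0 : (0%:E < e)%E. Proof. by case: admE. Qed.
Let Lq : L1loc_real e q. Proof. by case: admE. Qed.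

Lemma edge_graphP z (u du : fun1 R) :
  edge_graph E u du (z *: u) <-> wsol E z (u, du).
Proof.
split=> [[l2u _ s b]|w]; first exact/(wsolP admE).
have [s l2u b] := (wsolP admE z u du).1 w.
have [_ l2zu _] := (wsolP admE z _ _).1 (wsolZ admE z w).
by split.
Qed.

Lemma null_edgeP z U : sol e q z U -> null_edge E U.1 <-> forall t, edge e t -> U.1 t = 0.
Proof.
move=> [cU _ _ _]; split => [h|h]; first exact: null_cont.
exact: aeW.
Qed.

Lemma sol0 z : sol e q z (fun=> 0, fun=> 0).
Proof.
have z0 t : edge e t -> cprim (fun=> 0) t = 0 :> R[i].
  by move=> et; have t0 := edge_ge0 et; apply: complex_ext; rewrite /= prim_cst ?mul0r.
split; try exact: ccont_cst; move=> t et /=; first by rewrite z0 ?addr0.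
by rewrite add0r (@eq_cprim _ _ (fun=> 0)) ?z0 // => y _ _; rewrite mulr0.
Qed.

Lemma wsol0 z : wsol E z (fun=> 0, fun=> 0).
Proof.
split; first exact: sol0.
  exists 0 => t et; rewrite /intsq (@eq_prim _ _ (fun=> 0)) ?prim_cst ?mul0r ?(edge_ge0 et) //.
  by move=> y _ _; rewrite normsq0.
move=> _ d d0; exists 0; first exact: edge0.
by move=> t _ _; rewrite /wr /= !mul0r subrr normsq0.
Qed.

Lemma sol_eq0 U : sol e q x%:C U -> (forall t, edge e t -> U.1 t = 0) -> U.2 0 = 0.
Proof.
move=> [cU cdU eU _] h; apply: (cprim_eq0 cdU e0) => t et.
by have := eU t et; rewrite !h ?add0r //; exact: edge0.
Qed.

Lemma wsol_zero_data U : wsol E x%:C U -> U.1 0 = 0 -> U.2 0 = 0 ->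
  forall t, edge e t -> U.1 t = 0.
Proof. by move=> [sU _ _] h1 h2; apply: (sol_unique Lq sU (sol0 _)). Qed.

(** An eigenfunction has u'(0) nonzero, since zero data at 0 force u = 0; it can therefore be scaled
    to u'(0) = 1. *)
Lemma sigma_p_dirichletP :
  sigma_p_dirichlet E x <-> exists U, [/\ wsol E x%:C U, U.1 0 = 0 & U.2 0 = 1].
Proof.
split=> [[u nu [du /edge_graphP w u0]]|[U [wU U0 U1]]].
  have du0 : du 0 != 0.
    apply/negP => /eqP du0; apply: nu.
    have [s _ _] := w; apply/(null_edgeP s).
    exact: (wsol_zero_data w).
  exists (fun t => (du 0)^-1 * u t, fun t => (du 0)^-1 * du t).
  by split; [exact: (wsolZ admE _ w)|rewrite /= u0 mulr0|rewrite /= mulVf].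
have [sU _ _] := wU.
exists U.1; first move=> /(null_edgeP sU) h.
  by have := sol_eq0 sU h => /eqP; rewrite U1 oner_eq0.
by exists U.2 => //; apply/edge_graphP; case: U wU {U0 U1 sU}.
Qed.

End edge_spectrum.

Section multiplicity.
Context {K : fieldType} {V : lmodType K} (N : set V) (T : V -> V -> Prop) (z : K).

Lemma eigenvalue_of_multiplicity d : (0 < d)%N ->
  has_multiplicity N T z d -> eigenvalue_of N T z.
Proof.
case: d => // d _ [b [Tb ind _]]; exists (b ord0) => // Nb.
have := ind (fun i => (i == ord0)%:R).
rewrite (bigD1 ord0) //= big1 ?addr0 ?scale1r => [h|i /negbTE ->]; last by rewrite scale0r.
by have := h Nb ord0 => /eqP; rewrite eqxx oner_eq0.
Qed.

End multiplicity.

Section star.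
Context {R : realType} {n : nat} (G : 'I_n -> edge_data R).
Hypothesis adm : forall l, admissible (G l).
Variable x : R.
Implicit Types (u v : 'I_n -> fun1 R).

Lemma star_opP (u : 'I_n -> fun1 R) :
  star_op G u (x%:C *: u) <-> exists du : 'I_n -> fun1 R,
    [/\ forall l, wsol (G l) x%:C (u l, du l), forall k l, u k 0 = u l 0 &
        \sum_(l < n) du l 0 = 0].
Proof.
split=> -[du [h1 h2 h3]]; exists du; split => // l.
  by apply/(edge_graphP (adm l)); exact: h1.
by apply/(edge_graphP (adm l)).
Qed.

Lemma lincomb_eval d (c : 'I_d -> R[i]) (b : 'I_d -> 'I_n -> fun1 R) l t :
  (\sum_(i < d) c i *: b i) l t = \sum_(i < d) c i * b i l t.
Proof.
by elim/big_rec2: _ => // i y1 y2 _ <-.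
Qed.

Lemma mem_dirichlet l :
  (l \in [set l : 'I_n | `[< sigma_p_dirichlet (G l) x >] ]%SET) <->
  exists U, [/\ wsol (G l) x%:C U, U.1 0 = 0 & U.2 0 = 1].
Proof.
rewrite inE; split => [/asboolP h|h]; first exact/(sigma_p_dirichletP (adm l)).
by apply/asboolP/(sigma_p_dirichletP (adm l)).
Qed.

Lemma dirichlet_of_deriv l (U : cpair R) : wsol (G l) x%:C U -> U.1 0 = 0 -> U.2 0 != 0 ->
  l \in [set l : 'I_n | `[< sigma_p_dirichlet (G l) x >] ]%SET.
Proof.
move=> wU U0 U1; apply/mem_dirichlet.
exists (fun t => (U.2 0)^-1 * U.1 t, fun t => (U.2 0)^-1 * U.2 t).
by split; [exact: (wsolZ (adm l) _ wU)|rewrite /= U0 mulr0|rewrite /= mulVf].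
Qed.

(** With one Dirichlet edge [s0] singled out, each other Dirichlet edge contributes its
    eigenfunction minus that of [s0]: both are normalised to derivative 1 at the vertex, so the
    derivatives cancel. *)
Lemma multiplicity_pole : alternative_pole G x ->
  star_multiplicity G x (dirichlet_count G x - 1)%N.
Proof.
rewrite /alternative_pole /dirichlet_count; set S := [set l | _]%SET => S2.
have [s0 s0S] : exists s0, s0 \in S by apply/set0Pn; rewrite -card_gt0; exact: leq_trans S2.
(* Edges without the eigenvalue receive the zero solution, which makes [phi] total. *)
have phiP l : exists U, [/\ wsol (G l) x%:C U, U.1 0 = 0 & l \in S -> U.2 0 = 1].
  have [/mem_dirichlet[U [w U0 U1]]|lS] := boolP (l \in S); first by exists U.
  by exists (fun=> 0, fun=> 0); split => //; exact: (wsol0 (adm l)).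
have [phi {}phiP] := choice phiP.
have -> : (#|S| - 1)%N = #|(S :\ s0)%SET| by rewrite (cardsD1 s0) s0S addKn.
set S' := (S :\ s0)%SET.
pose ev (i : 'I_#|S'|) : 'I_n := enum_val i.
have evS i : ev i \in S' by exact: enum_valP.
have ev0 i : (ev i == s0) = false by apply/negbTE; have := evS i; rewrite in_setD1 => /andP[].
have evS1 i : ev i \in S by have := evS i; rewrite in_setD1 => /andP[].
pose k i l : R[i] := if l == ev i then 1 else if l == s0 then -1 else 0.
exists (fun i l t => k i l * (phi l).1 t); split.
- move=> i; apply/star_opP; exists (fun l t => k i l * (phi l).2 t); split.
  + by move=> l; apply: (wsolZ (adm l)); case: (phiP l).
  + by move=> l l'; case: (phiP l) => _ -> _; case: (phiP l') => _ -> _; rewrite !mulr0.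
  + rewrite (bigD1 s0) //= (bigD1 (ev i)) ?ev0 //= big1 => [|l /andP[l1 l2]].
      rewrite /k eqxx eq_sym ev0 eqxx; case: (phiP s0) => _ _ -> //.
      by case: (phiP (ev i)) => _ _ -> //; ring.
    by rewrite /k (negbTE l1) (negbTE l2) mul0r.
- move=> c Nc i.
  have [w p0 p1] := phiP (ev i); have [s _ _] := w.
  have := Nc (ev i); set f := (X in null_edge _ X).
  (* On the edge [ev i] only the basis vector of index [i] is nonzero, so the coefficients
     separate. *)
  have -> : f = fun t => c i * (phi (ev i)).1 t.
    apply/funext => t; rewrite /f lincomb_eval (bigD1 i) //= big1 ?addr0.
      by rewrite /k eqxx mul1r.
    move=> j ji; rewrite /k ev0 (inj_eq enum_val_inj) eq_sym (negbTE ji).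
    by rewrite mul0r mulr0.
  have sc := solZ (admissible_L1 (adm (ev i))) (c i) s.
  move=> /(null_edgeP sc)/(sol_eq0 (adm (ev i)) sc) /=.
  by rewrite p1 // mulr1.
- move=> v /star_opP[dv [wv vv dv0]].
  (* On [s0] the Wronskian with the Dirichlet eigenfunction forces the value 0 at the vertex, and
     continuity there carries it to all edges. *)
  have v0 l : v l 0 = 0.
    rewrite (vv l s0); have [w p0 p1] := phiP s0.
    have := wsol_wronskian0 (adm s0) (wv s0) w.
    by rewrite /wr /= p1 // p0 mulr1 mulr0 subr0.
  have dvS l : l \notin S -> dv l 0 = 0.
    move=> lS; apply/eqP/negPn/negP => dl; move/negP: lS; apply.
    exact: (dirichlet_of_deriv (wv l) (v0 l) dl).
  exists (fun i => dv (ev i) 0) => l.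
  set f := (v - _) l.
  pose r := \sum_(i < #|S'|) dv (ev i) 0 * k i l.
  have fE : f = fun t => v l t - r * (phi l).1 t.
    apply/funext => t; rewrite /f; congr (_ - _).
    rewrite lincomb_eval /r mulr_suml; apply: eq_bigr => i _.
    by rewrite mulrA.
  apply: aeW => t et; rewrite fE; apply/eqP; rewrite subr_eq0; apply/eqP.
  have [w p0 p1] := phiP l; have [sp _ _] := w; have [sv _ _] := wv l.
  have Lq := admissible_L1 (adm l).
  have := sol_unique Lq sv (solZ Lq r sp).
  rewrite /= v0 p0 mulr0 => /(_ erefl); apply => //.
  have [lS|lS] := boolP (l \in S); last first.
    rewrite dvS // /r big1 ?mul0r // => i _; rewrite /k.
    have /negbTE -> : l != ev i by apply: contraNneq lS => ->.
    have /negbTE -> : l != s0 by apply: contraNneq lS => ->.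
    by rewrite mulr0.
  rewrite p1 // mulr1 /r.
  have [->|ls0] := eqVneq l s0.
    (* The derivative on [s0] is not free: the sum condition at the vertex makes it minus the sum
       over [S']. *)
    move: dv0; rewrite (bigD1 s0) //= (bigID (mem S)) /= [X in _ + (_ + X)]big1; last first.
      by move=> j /andP[_ /dvS].
    rewrite addr0 (eq_bigl (mem S')); last by move=> j; rewrite /= in_setD1.
    rewrite big_enum_val => /eqP; rewrite addr_eq0 => /eqP ->.
    rewrite -sumrN; apply: eq_bigr => i _.
    by rewrite /k eq_sym ev0 eqxx mulrN1.
  have lS' : l \in S' by rewrite in_setD1 ls0.
  pose i := enum_rank_in lS' l.
  have evi : ev i = l by rewrite /ev enum_rankK_in.
  rewrite (bigD1 i) //= big1 ?addr0; first by rewrite /k evi eqxx mulr1.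
  move=> j ji; rewrite /k -evi (inj_eq enum_val_inj) eq_sym (negbTE ji) ev0.
  by rewrite mulr0.
Qed.

Variable m : 'I_n -> R[i] -> R[i].
Hypothesis wm : forall l, weyl_function (G l) (m l).

Lemma multiplicity_zero : (0 < n)%N -> alternative_zero m x -> star_multiplicity G x 1%N.
Proof.
move=> n0 [mx [c1 c2 s0]].
have PU l : exists U, [/\ wsol (G l) x%:C U, U.1 0 = 1 & U.2 0 = (mx l)%:C].
  by have [c c0 h] := c2 l; exact: (wsol_of_weyl_limit (adm l) (wm l) c0 (c1 l) h).
have [U {}PU] := choice PU.
pose l0 : 'I_n := Ordinal n0.
exists (fun _ l => (U l).1); split.
- move=> _; apply/star_opP; exists (fun l => (U l).2); split.
  + by move=> l; case: (PU l) => w _ _; move: w; case: (U l).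
  + by move=> k l; case: (PU k) => _ -> _; case: (PU l) => _ -> _.
  + rewrite (eq_bigr (fun l => (mx l)%:C)); last by move=> l _; case: (PU l).
    by rewrite -(rmorph_sum (real_complex R)) s0.
- move=> c Nc i; rewrite (ord1 i).
  have [w U0 _] := PU l0; have [s _ _] := w.
  have := Nc l0; set f := (X in null_edge _ X).
  have -> : f = fun t => c ord0 * (U l0).1 t.
    by apply/funext => t; rewrite /f lincomb_eval big_ord1.
  have sc := solZ (admissible_L1 (adm l0)) (c ord0) s.
  move=> /(null_edgeP sc) /(_ 0) /=; rewrite U0 mulr1; apply.
  by apply: edge0; case: (adm l0).
- move=> v /star_opP[dv [wv vv _]].
  (* The coefficient is the common vertex value; the derivatives then agree because Weyl solutions
     have proportional data at 0. *)
  exists (fun=> v l0 0) => l; set f := (v - _) l.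
  have fE : f = fun t => v l t - v l0 0 * (U l).1 t.
    by apply/funext => t; rewrite /f; congr (_ - _); rewrite lincomb_eval big_ord1.
  apply: aeW => t et; rewrite fE; apply/eqP; rewrite subr_eq0; apply/eqP.
  have [w U0 U1] := PU l; have [sU _ _] := w; have [sv _ _] := wv l.
  have Lq := admissible_L1 (adm l).
  apply: (sol_unique Lq sv (solZ Lq (v l0 0) sU)) => //=; first by rewrite U0 mulr1.
  have := wsol_wronskian0 (adm l) (wv l) w.
  by rewrite /wr /= U0 mulr1 (vv l l0) => /eqP; rewrite subr_eq0 => /eqP ->.
Qed.

Lemma sigma_p_star_alternatives : (0 < n)%N -> sigma_p_star G x ->
  alternative_pole G x \/ alternative_zero m x.
Proof.
move=> n0 [v nv /star_opP[dv [wv vv dv0]]].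
pose l0 : 'I_n := Ordinal n0.
(* The vertex value decides. If it is zero, some derivative is nonzero and the vanishing sum
   requires a second one; otherwise division by it normalises the solution on every edge. *)
have [c0|c0] := eqVneq (v l0 0) 0; [left|right].
  have v0 l : v l 0 = 0 by rewrite (vv l l0).
  have [l dl] : exists l, dv l 0 != 0.
    apply: contrapT => H; apply: nv => l; have [s _ _] := wv l.
    apply/(null_edgeP s); apply: (wsol_zero_data (adm l) (wv l)) => //=.
    by apply/eqP/negPn/negP => h; apply: H; exists l.
  have [k kl dk] : exists2 k, k != l & dv k 0 != 0.
    apply: contrapT => H; move/eqP: dl; apply.
    move: dv0; rewrite (bigD1 l) //= big1 ?addr0 // => k kl.
    by apply/eqP/negPn/negP => h; apply: H; exists k.
  have lS := dirichlet_of_deriv (wv l) (v0 l) dl.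
  have kS := dirichlet_of_deriv (wv k) (v0 k) dk.
  rewrite /alternative_pole /dirichlet_count.
  have <- : #|[set k; l]%SET| = 2%N by rewrite cards2 kl.
  by apply: subset_leq_card; apply/fintype.subsetP => j; rewrite in_set2 => /orP[] /eqP ->;
    [move: kS|move: lS]; rewrite inE.
pose U l : cpair R := (fun t => (v l0 0)^-1 * v l t, fun t => (v l0 0)^-1 * dv l t).
have wU l : wsol (G l) x%:C (U l) by exact: (wsolZ (adm l) _ (wv l)).
have U0 l : (U l).1 0 = 1 by rewrite /= (vv l l0) mulVf.
exists (fun l => complex.Re ((U l).2 0)); split.
- by move=> l; case: (weyl_limit (adm l) (wm l) (wU l) (U0 l)).
- by move=> l; case: (weyl_limit (adm l) (wm l) (wU l) (U0 l)).
- apply: (@complexI R); rewrite (rmorph_sum (real_complex R)) /=.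
  rewrite (eq_bigr (fun l => (v l0 0)^-1 * dv l 0)); last first.
    move=> l _; apply: complex_ext => //=.
    by rewrite (wsol_real (adm l) (wU l) (U0 l)).
  by rewrite -mulr_sumr dv0 mulr0.
Qed.

End star.

Theorem theorem1p3 (R : realType) (n : nat) (G : 'I_n -> edge_data R)
    (m : 'I_n -> R[i] -> R[i]) (x : R) :
  (0 < n)%N ->
  (forall l, admissible (G l)) ->
  (forall l, weyl_function (G l) (m l)) ->
  [/\ sigma_p_star G x <-> alternative_pole G x \/ alternative_zero m x,
      alternative_pole G x ->
        star_multiplicity G x (dirichlet_count G x - 1)%N &
      alternative_zero m x -> star_multiplicity G x 1%N].
Proof.
move=> n0 adm wm; split.
- split; first exact: sigma_p_star_alternatives.
  (* Both alternatives give a positive multiplicity, hence an eigenvalue. *)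
  case=> [p|z]; last exact: (eigenvalue_of_multiplicity (ltnSn 0) (multiplicity_zero adm wm n0 z)).
  by apply: (eigenvalue_of_multiplicity _ (multiplicity_pole adm p)); rewrite subn_gt0.
- exact: multiplicity_pole.
- exact: multiplicity_zero.
Qed.
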